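(* Let $H$ be a connected multicyclic graph with 2-core $H'$ such that exactly $t=1$ vertex of $H$ is not in $H'$ (that is, $H$ is obtained from a connected, multicyclic and leaf-free graph $H'$ by attaching a single pendant edge), and let $m\ge m_H$ be an integer. Let $W_n$ and $W'_n$ be the numbers of copies of $H$ and $H'$, respectively, in the uniform attachment graph $G^m_n$, and let $W'_\infty$ be the number of copies of $H'$ in $G^m_\infty$. Then there exists a constant $c>0$ such that, as $n\to\infty$, $$(\log n)^{-1}W_n-c\,W'_n\to0\quad\text{almost surely},$$ and thus $$\frac{W_n}{\log n}\to c\,W'_\infty\quad\text{almost surely}.$$
   Context: Uniform attachment graph: for an integer $m\ge1$, choose for every integer $j\ge2$ and every label $a\in[m]=\{1,\dots,m\}$ a vertex uniformly at random in $[j-1]$, all choices being independent, and let $j^{(a)}$ be an edge with label $a$ from $j$ to that vertex. $G^m_\infty$ is the resulting random loopless multigraph on vertex set $\{1,2,\dots\}$, and $G^m_n$ is its restriction to $[n]=\{1,\dots,n\}$; so $G^m_\infty=\bigcup_n G^m_n$. Parallel edges are allowed and are distinguished by their labels. $K^m_n$ is the multigraph on $[n]$ having, for every $1\le i<j\le n$, exactly $m$ edges $ji^{(1)},\dots,ji^{(m)}$ between $j$ and $i$; $G^m_n$ is regarded as a random subgraph of $K^m_n$. Graphs may be loopless multigraphs (a pair of parallel edges is a cycle of length 2); $H$ and $H'$ are finite. A copy of $H$ in a graph $G$ is a (not necessarily induced) subgraph of $G$ isomorphic to $H$ as an undirected, unlabelled multigraph; two copies are different if they differ as subgraphs (also if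 they differ only in edge labels). A potential copy of $H$ in $G^m_n$ is a copy of $H$ in $K^m_n$ that does not contain two different edges $ji_1^{(a)}$, $ji_2^{(a)}$ with $i_1,i_2<j$ and the same label $a$. The integer $m_H\ge1$ is such that for $m<m_H$ there are no potential copies of $H$ in $G^m_n$ for any $n$, while for $m\ge m_H$ there are potential copies for all large enough $n$. A graph is multicyclic if it has at least two (not necessarily edge- or vertex-disjoint) cycles; it is leaf-free if it has no vertex of degree 1. The 2-core $H'$ of a connected multicyclic graph $H$ is the connected, multicyclic and leaf-free graph from which $H$ is obtained by attaching rooted trees at vertices of $H'$. The constant $c$ may depend on $m$ and $H$ but is not random. *)

(* Defs.v *)
From HB Require Import structures.
From mathcomp Require Import all_boot all_order all_algebra finmap.
From mathcomp Require Import all_classical all_reals all_analysis.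
From Stdlib Require Import Relation_Operators.
Set Implicit Arguments.
Unset Strict Implicit.
Unset Printing Implicit Defensive.
Import Order.TTheory GRing.Theory Num.Theory.
Import numFieldNormedType.Exports.
Local Open Scope classical_set_scope.
Local Open Scope ring_scope.

(* Vertices and edges are sets inside ambient types, so that a graph and its
   subgraphs live over the same types.  The values of [ends] outside [edges]
   are irrelevant. *)
Record mgraph (V E : Type) := MGraph {
  verts : set V;
  edges : set E;
  ends : E -> set V }.

Definition loopless_multigraph V E (G : mgraph V E) : Prop :=
  forall e, edges G e ->
    exists x y, [/\ verts G x, verts G y, x <> y & ends G e = [set x; y]].

Definition finite_mgraph V E (G : mgraph V E) : Prop :=
  finite_set (verts G) /\ finite_set (edges G).

Definition subgraph V E (G' G : mgraph V E) : Prop :=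
  [/\ verts G' `<=` verts G, edges G' `<=` edges G
    & forall e, edges G' e -> ends G' e = ends G e /\ ends G' e `<=` verts G'].

(* A subgraph of G is determined by its vertex and edge sets. *)
Definition sub_mgraph V E (G : mgraph V E) (S : set V * set E) : mgraph V E :=
  MGraph S.1 S.2 (ends G).

Definition induced V E (G : mgraph V E) (A : set V) : mgraph V E :=
  sub_mgraph G (verts G `&` A, [set e | edges G e /\ ends G e `<=` A]).

Definition isomorphic V1 E1 V2 E2 (G1 : mgraph V1 E1) (G2 : mgraph V2 E2) :
    Prop :=
  exists (f : V1 -> V2) (g : E1 -> E2),
    [/\ set_bij (verts G1) (verts G2) f, set_bij (edges G1) (edges G2) g
      & forall e, edges G1 e -> ends G2 (g e) = f @` ends G1 e].

Definition copies V1 E1 V2 E2 (H : mgraph V1 E1) (G : mgraph V2 E2) :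
    set (set V2 * set E2) :=
  [set S | subgraph (sub_mgraph G S) G /\ isomorphic H (sub_mgraph G S)].

Definition ncopies (R : realType) V1 E1 V2 E2
    (H : mgraph V1 E1) (G : mgraph V2 E2) : \bar R :=
  counting (copies H G).

Definition adjacent V E (G : mgraph V E) (x y : V) : Prop :=
  exists2 e, edges G e & ends G e = [set x; y].

Definition connected_mgraph V E (G : mgraph V E) : Prop :=
  verts G !=set0 /\
  forall x y, verts G x -> verts G y -> clos_refl_trans V (adjacent G) x y.

(* For k = 2 this consists of two parallel edges. *)
Definition cycle_mgraph (k : nat) : mgraph nat nat :=
  MGraph `I_k `I_k (fun i => [set i; (i.+1 %% k)%N]).

Definition cycles V E (G : mgraph V E) : set (set V * set E) :=
  [set S | exists2 k, (2 <= k)%N & copies (cycle_mgraph k) G S].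

Definition multicyclic V E (G : mgraph V E) : Prop :=
  exists S1 S2, [/\ cycles G S1, cycles G S2 & S1 <> S2].

Definition tree V E (G : mgraph V E) : Prop :=
  connected_mgraph G /\ cycles G = set0.

Definition incident V E (G : mgraph V E) (x : V) : set E :=
  [set e | edges G e /\ ends G e x].

Definition leaf_free V E (G : mgraph V E) : Prop :=
  forall x, verts G x -> ~ (incident G x #= `I_1)%card.

(* [root] sends every vertex of H to the vertex of H' at which the rooted tree
   containing it is attached; the tree at r may be reduced to r. *)
Definition attach_trees V E (H H' : mgraph V E) : Prop :=
  exists root : V -> V,
    [/\ forall x, verts H x -> verts H' (root x),
        forall x, verts H' x -> root x = x,
        (forall e, edges H e -> ~ edges H' e ->
           forall x y, ends H e x -> ends H e y -> root x = root y)
      & forall r, verts H' r ->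
          tree (sub_mgraph H
            ([set x | verts H x /\ root x = r],
             [set e | [/\ edges H e, ~ edges H' e
                        & forall x, ends H e x -> root x = r]]))].

Definition two_core V E (H H' : mgraph V E) : Prop :=
  [/\ subgraph H' H, connected_mgraph H', multicyclic H', leaf_free H'
    & attach_trees H H'].

(* The edge from j down to i with label a is the triple (j, i, a). *)
Definition edge_ends (e : nat * nat * nat) : set nat := [set e.1.1; e.1.2].

Definition Kmn (m n : nat) : mgraph nat (nat * nat * nat) :=
  MGraph [set i | (1 <= i <= n)%N]
    [set e | let: (j, i, a) := e in (1 <= i < j)%N && (j <= n)%N
                                    && (1 <= a <= m)%N]
    edge_ends.

Definition potential_copies V E (H : mgraph V E) (m n : nat) :
    set (set nat * set (nat * nat * nat)) :=
  [set S | copies H (Kmn m n) S /\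
    forall j i1 i2 a, S.2 (j, i1, a) -> S.2 (j, i2, a) -> i1 = i2].

Definition is_mH V E (H : mgraph V E) (mH : nat) : Prop :=
  [/\ (1 <= mH)%N,
      forall m, (m < mH)%N -> forall n, potential_copies H m n = set0
    & forall m, (mH <= m)%N ->
        exists N, forall n, (N <= n)%N -> potential_copies H m n !=set0].

Definition mutually_independent (d d' : measure_display) (T : measurableType d)
    (T' : measurableType d') (R : realType) (P : probability T R)
    (I : choiceType) (J : set I) (X : I -> {RV P >-> T'}) : Prop :=
  forall (s : {fset I}) (B : I -> set T'),
    [set` s] `<=` J -> (forall k, measurable (B k)) ->
    P (\bigcap_(k in [set` s]) (X k @^-1` B k))
      = (\prod_(k <- s) P (X k @^-1` B k))%E.

(* U (j, a) is the vertex chosen by j for its edge with label a. *)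
Definition uniform_attachment (d : measure_display) (T : measurableType d)
    (R : realType) (P : probability T R) (m : nat)
    (U : nat * nat -> {RV P >-> nat}) : Prop :=
  let J := [set k : nat * nat | (2 <= k.1)%N && (1 <= k.2 <= m)%N] in
  [/\ forall k, J k -> forall w, (1 <= U k w < k.1)%N,
      (forall k, J k -> forall i, (1 <= i < k.1)%N ->
         P (U k @^-1` [set i]) = ((k.1.-1)%:R^-1)%:E)
    & mutually_independent J U].

Definition Gm_infty (T : Type) (m : nat) (U : nat * nat -> T -> nat) (w : T) :
    mgraph nat (nat * nat * nat) :=
  MGraph [set i | (1 <= i)%N]
    [set e | let: (j, i, a) := e in
             [/\ (2 <= j)%N, (1 <= a <= m)%N & i = U (j, a) w]]
    edge_ends.

Definition Gmn (T : Type) (m : nat) (U : nat * nat -> T -> nat) (n : nat)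
    (w : T) : mgraph nat (nat * nat * nat) :=
  induced (Gm_infty m U w) [set i | (1 <= i <= n)%N].

(* Main.v *)
(* A copy of [H] in [G_n] is a copy [C] of the 2-core [H'] together with an edge
   leaving [C] from one of the vertices of [C] that can play the role of the
   attachment vertex [r]; the number of these vertices is the size of the orbit
   of [r] under the automorphisms of [H'].  Almost surely every fixed vertex has
   degree asymptotic to [m * ln n], and [H'] has only finitely many copies in
   the infinite graph, so [W_n / ln n] tends to [m * orbit size * W'_oo].

   Degrees: Chebyshev's inequality and Borel-Cantelli along [n = 2^((k+1)^2)],
   then monotone interpolation.

   Finiteness: the expected number of copies is at most a constant times the
   sum over vertex labellings [F] of the product over edges [e = xy] of
   [1 / max (F x) (F y)].  As [H'] is connected with minimum degree at least 2
   and is not a cycle, any nonempty set [A] of vertices touches at least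
   [#|A| + 1] edges.  Applied to the superlevel sets of [F] this bounds the
   product by that of the [F(v)^(-1 - 1/k)], where [k] is the number of vertices,
   and the sum over labellings is then the [k]-th power of a convergent series. *)
Require Import Defs.
From mathcomp Require Import all_boot all_order all_algebra finmap.
From mathcomp Require Import all_classical all_reals all_analysis.
From mathcomp Require Import measurable_realfun.
From mathcomp Require Import zify ring lra.
From Stdlib Require Import Relation_Operators Operators_Properties.
Set Implicit Arguments.
Unset Strict Implicit.
Unset Printing Implicit Defensive.
Import Order.TTheory GRing.Theory Num.Theory.
Import numFieldNormedType.Exports.
Local Open Scope classical_set_scope.
Local Open Scope ring_scope.

(** * Labellings of a finite graph *)

(** The product telescopes. Its range depends only on the common bound [M], so it can be exchanged
    with products over vertices and edges. *)
Lemma natr_telescope (R : realType) (M n : nat) : (1 <= n <= M)%N ->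
  n%:R = \prod_(1 <= x < M) (if (x < n)%N then x.+1%:R / x%:R else 1) :> R.
Proof.
move=> /andP[n1 nM].
rewrite (big_cat_nat n1 nM) /= [X in _ * X]big_nat [X in _ * X]big1 ?mulr1; last first.
  by move=> i /andP[ni _]; rewrite ltnNge ni.
rewrite big_nat (eq_bigr (fun x => x.+1%:R / x%:R : R)); last first.
  by move=> i /andP[_ ->].
rewrite -big_nat; have [n2|] := ltnP 1 n; last first.
  by move=> n2; rewrite big_geq// (_ : n = 1%N)//; apply/eqP; rewrite eqn_leq n2.
rewrite telescope_prodf ?divr1//.
by move=> i /andP[i1 _]; rewrite pnatr_eq0; lia.
Qed.

Section FiniteGraph.
Variables (VT ET : finType) (s t : ET -> VT).
Hypothesis st : forall e, s e != t e.
Hypothesis deg_ge2 : forall v, (2 <= #|[pred e | (s e == v) || (t e == v)]|)%N.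
Hypothesis cut : forall A : pred VT, (0 < #|A|)%N -> (#|A| < #|VT|)%N ->
  exists e, A (s e) != A (t e).
Hypothesis deg_ge3 : exists v, (3 <= #|[pred e | (s e == v) || (t e == v)]|)%N.

(** Double counting: the degrees over [A] add up to at least [2 * #|A|], and this sum counts each
    touching edge at most twice. Strictness comes from an edge leaving [A], counted once, if [A] is
    proper, and from the vertex of degree at least 3 otherwise. *)
Lemma card_touching_gt (A : pred VT) : (0 < #|A|)%N ->
  (#|A| < #|[pred e | A (s e) || A (t e)]|)%N.
Proof.
move=> A0.
have degE : (\sum_(v | A v) #|[pred e | (s e == v) || (t e == v)]|
            = \sum_e (A (s e) + A (t e)))%N.
  rewrite (eq_bigr (fun v => \sum_e ((s e == v) + (t e == v))))%N; last first.
    move=> v _; rewrite -sum1_card big_mkcond /=; apply: eq_bigr => e _.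
    (* Without loops the two indicators are never both 1, so their sum is the disjunction. *)
    have := st e; rewrite inE.
    by case: (eqVneq (s e) v) => [->|_]; rewrite ?(eq_sym v); case: eqVneq.
  rewrite exchange_big /=; apply: eq_bigr => e _.
  rewrite big_split /= !(big_mkcond A) /=; congr addn.
    rewrite (bigD1 (s e))//= eqxx big1 ?addn0; first by case: (A _).
    by move=> v; rewrite eq_sym => /negbTE ->; rewrite if_same.
  rewrite (bigD1 (t e))//= eqxx big1 ?addn0; first by case: (A _).
  by move=> v; rewrite eq_sym => /negbTE ->; rewrite if_same.
have sumge : (2 * #|A| <= \sum_e (A (s e) + A (t e)))%N.
  rewrite -degE mulnC -sum_nat_const; apply: leq_sum => v _; exact: deg_ge2.
have sumle : (\sum_e (A (s e) + A (t e)) <=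
    \sum_e (2 * (A (s e) || A (t e))))%N.
  by apply: leq_sum => e _; case: (A _); case: (A _).
have touchE : (\sum_e (2 * (A (s e) || A (t e))) =
    2 * #|[pred e | A (s e) || A (t e)]|)%N.
  by rewrite -big_distrr /= -sum1_card [in RHS]big_mkcond; congr muln.
have [AT|AV] := ltnP #|A| #|VT|.
  have [e0 Ae0] := cut A0 AT.
  suff : (\sum_e (A (s e) + A (t e)) < \sum_e (2 * (A (s e) || A (t e))))%N.
    rewrite touchE; lia.
  rewrite (bigD1 e0)//= [in leqRHS](bigD1 e0)//= -addSn leq_add//.
    by move: Ae0; case: (A _); case: (A _).
  by apply: leq_sum => e _; case: (A _); case: (A _).
have AT : A =i predT.
  apply/subset_cardP; last by apply/fintype.subsetP.
  by apply/eqP; rewrite eqn_leq AV max_card.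
suff : (2 * #|A| < \sum_e (A (s e) + A (t e)))%N by rewrite -ltnS; lia.
have [v v3] := deg_ge3.
have Av : A v by rewrite -[A v]/(v \in A) AT.
rewrite -degE mulnC -sum_nat_const (bigD1 v)//= [ltnRHS](bigD1 v)//= -addSn.
by apply: leq_add => //; apply: leq_sum => u _; exact: deg_ge2.
Qed.

(* Layer-cake: writing [n] as the product of [(x+1)/x] over [x < n], the level
   [x] contributes [(x+1)/x] once for every vertex with label above [x] on the
   left and once for every edge touching such a vertex on the right. *)
Lemma prod_vertices_le (R : realType) (F : VT -> nat) (v0 : VT) :
    (forall v, (1 <= F v)%N) ->
  (\prod_v (F v)%:R) * (F v0)%:R <= \prod_e (maxn (F (s e)) (F (t e)))%:R :> R.
Proof.
move=> F1.
pose M := \max_v F v.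
have FM v : (F v <= M)%N by exact: leq_bigmax.
pose r x : R := x.+1%:R / x%:R.
have r1 x : (1 <= x)%N -> 1 <= r x.
  by move=> x1; rewrite ler_pdivlMr ?ltr0n// mul1r ler_nat.
under eq_bigr => v _ do rewrite (@natr_telescope R M) ?F1 ?FM//.
under [leRHS]eq_bigr => e _ do
  rewrite (@natr_telescope R M) ?geq_max ?leq_max ?F1 ?FM//.
rewrite (@natr_telescope R M (F v0)) ?F1 ?FM//.
rewrite exchange_big /= [leRHS]exchange_big /= -big_split /= !big_nat.
apply: ler_prod => x /andP[x1 _]; rewrite -!/(r x).
have expE (I : finType) (Q : pred I) :
    \prod_i (if Q i then r x else 1) = r x ^+ #|Q|.
  by rewrite -big_mkcond prodr_const.
pose A : pred VT := fun v => (x < F v)%N.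
rewrite (expE _ A) (expE _ (fun e => x < maxn (F (s e)) (F (t e)))%N).
rewrite -[(x < F v0)%N]/(A v0).
pose B : pred ET := fun e => (x < maxn (F (s e)) (F (t e)))%N.
(* The edges in [B] are exactly those touching the superlevel set [A]. *)
have AB : (0 < #|A| -> #|A| < #|B|)%N.
  move=> /card_touching_gt/leq_trans; apply; rewrite eq_leq//.
  by apply: eq_card => e; rewrite !inE unfold_in /B leq_max.
rewrite -/B.
have r0 : 0 <= r x by exact: le_trans (r1 _ x1).
(* At a level below [F v0] the left side has one more factor [r x], which the strict inequality [AB]
   pays for. *)
case: ifPn => Av0; rewrite ?mulr1 ?exprn_ge0 ?mulr_ge0 ?exprn_ge0//=.
  rewrite -exprSr ler_weXn2l ?r1// AB//.
  by apply/card_gt0P; exists v0.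
rewrite ler_weXn2l ?r1//.
have [A0|/AB/ltnW//] := posnP #|A|.
by rewrite A0.
Qed.
End FiniteGraph.

(** * The convergent series with exponent slightly above 1 *)

Section PowerSums.
Variables (R : realType) (k : nat).
Hypothesis k0 : (0 < k)%N.

(** This is [i^(-1/k)], so [vertex_weight] is [i^(-1-1/k)], with value 0 at [i = 0]. *)
Definition inv_root (i : nat) : R := i%:R `^ (- k%:R^-1).
Definition vertex_weight (i : nat) : R := inv_root i / i%:R.

Lemma inv_root_ge0 i : 0 <= inv_root i.
Proof. exact: powR_ge0. Qed.

Lemma inv_root_exp i : inv_root i ^+ k = i%:R^-1.
Proof.
rewrite /inv_root -powR_mulrn ?powR_ge0// -powRrM mulNr mulVf ?pnatr_eq0 -?lt0n//.
by rewrite powR_inv1.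
Qed.

Lemma le_inv_root i j : (0 < i <= j)%N -> inv_root j <= inv_root i.
Proof.
move=> /andP[i0 ij]; rewrite -(@ler_pXn2r _ k) ?nnegrE ?inv_root_ge0//.
by rewrite !inv_root_exp lef_pV2 ?posrE ?ltr0n ?ler_nat// (leq_trans i0).
Qed.

Lemma vertex_weight_ge0 i : 0 <= vertex_weight i.
Proof. by rewrite mulr_ge0 ?inv_root_ge0. Qed.

(** Discrete counterpart of [x^(-1-1/k)] being the derivative of [-k x^(-1/k)]: split the factor
    [a - b] off [a^k - b^k] and bound each of the [k] terms of the cofactor by [a^(k-1)]. *)
Lemma vertex_weightS_le i : (0 < i)%N ->
  vertex_weight i.+1 <= k%:R * (inv_root i - inv_root i.+1).
Proof.
move=> i0; have i0' : (0 : R) < i%:R by rewrite ltr0n.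
set a := inv_root i; set b := inv_root i.+1.
have a0 : 0 < a by rewrite powR_gt0.
have b0 : 0 <= b by exact: inv_root_ge0.
have ba : b <= a by apply: le_inv_root; rewrite i0 leqnSn.
have ak : a ^+ k = i%:R^-1 by exact: inv_root_exp.
have bk : b ^+ k = i.+1%:R^-1 by exact: inv_root_exp.
have : a ^+ k - b ^+ k <= (a - b) * (k%:R * a ^+ k.-1).
  rewrite subrXX ler_wpM2l ?subr_ge0//.
  rewrite mulr_natl -[X in _ *+ X](card_ord k) -sumr_const.
  apply: ler_sum => j _.
  apply: (@le_trans _ _ (a ^+ (k.-1 - j) * a ^+ j)).
    by rewrite ler_wpM2l ?exprn_ge0 ?lerXn2r ?nnegrE// ltW.
  by rewrite -exprD subnK// -ltnS prednK.
rewrite ak bk => H.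
have aE : a ^+ k.-1 = (i%:R * a)^-1.
  by rewrite invfM -ak -[in RHS](prednK k0) exprSr mulfK ?gt_eqF.
rewrite aE in H.
rewrite /vertex_weight -/b.
apply: (@le_trans _ _ (a / i.+1%:R)).
  by rewrite ler_wpM2r ?invr_ge0.
have -> : a / i.+1%:R = (i%:R^-1 - i.+1%:R^-1) * (i%:R * a).
  rewrite -natr1; field; lra.
rewrite -ler_pdivlMr ?mulr_gt0// (le_trans H)//.
by rewrite mulrCA mulrA.
Qed.

Lemma sum_vertex_weight_le N :
  \sum_(0 <= i < N) vertex_weight i <= 1 + k%:R.
Proof.
have w1 : vertex_weight 1 = 1 by rewrite /vertex_weight /inv_root powR1 divr1.
have w0 : vertex_weight 0 = 0 by rewrite /vertex_weight invr0 mulr0.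
case: N => [|N]; first by rewrite big_nil.
(* The bound keeps the remainder in [inv_root N.+1], so that the increments telescope in the
   induction. *)
suff : \sum_(0 <= i < N.+2) vertex_weight i <= 1 + k%:R * (1 - inv_root N.+1).
  move=> h; apply: le_trans (le_trans h _).
    by rewrite [leRHS]big_nat_recr//= lerDl vertex_weight_ge0.
  by rewrite lerD2l ler_piMr// gerBl inv_root_ge0.
elim: N => [|N IH].
  by rewrite !big_nat_recr ?big_nil//= w0 w1 !add0r /inv_root powR1 subrr mulr0 addr0.
rewrite big_nat_recr//=.
apply: le_trans (lerD IH (vertex_weightS_le _)) _ => //.
by rewrite -addrA -mulrDr addrA subrK.
Qed.
End PowerSums.

(** Take [v0] maximizing [F]. With [k] vertices, the spare factor [1 / F v0] is a product of [k]
    factors [F(v0)^(-1/k)], one for each vertex [v] and at most [F(v)^(-1/k)]. *)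
Lemma prod_edges_le (R : realType) (VT ET : finType) (s t : ET -> VT)
    (F : VT -> nat) :
  (forall v0, (\prod_v (F v)%:R) * (F v0)%:R <=
     \prod_e (maxn (F (s e)) (F (t e)))%:R :> R) ->
  (0 < #|VT|)%N -> (forall v, (1 <= F v)%N) ->
  \prod_e (maxn (F (s e)) (F (t e)))%:R^-1
    <= \prod_v vertex_weight R #|VT| (F v).
Proof.
move=> H V0 F1.
have [v1 _] : exists v : VT, true by case/card_gt0P : (V0) => v _; exists v.
have [v0 _ v0max] := @arg_maxnP _ v1 predT F isT.
rewrite /vertex_weight big_split /= !prodfV.
have P0 : 0 < \prod_v (F v)%:R :> R by apply: prodr_gt0 => v _; rewrite ltr0n.
apply: (@le_trans _ _ ((F v0)%:R^-1 * (\prod_v (F v)%:R)^-1)).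
  rewrite -invfM mulrC lef_pV2 ?posrE//.
    by apply: prodr_gt0 => e _; rewrite ltr0n leq_max F1.
  by rewrite mulr_gt0// ltr0n.
rewrite ler_wpM2r ?invr_ge0 ?(ltW P0)//.
rewrite -(inv_root_exp R V0) -prodr_const.
apply: ler_prod => v _; rewrite inv_root_ge0 le_inv_root// F1/=.
exact: v0max.
Qed.

(** * Finitely many embeddings *)

Section Negligible.
Context (d : measure_display) (T : measurableType d) (R : realType).
Variable P : probability T R.

Lemma Boole_finType (I : finType) (A : I -> set T) (B : set T) :
  (forall i, measurable (A i)) -> measurable B ->
  (forall w, B w -> exists i, A i w) -> (P B <= \sum_i P (A i))%E.
Proof.
move=> mA mB BA.
apply: (@le_trans _ _ (P (\big[setU/set0]_i A i))).
  apply: le_measure; rewrite ?inE//; first exact: bigsetU_measurable.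
  by move=> w /BA[i Aiw]; rewrite -bigcup_seq; exists i => //=; rewrite mem_index_enum.
elim: (index_enum I) => [|i s IH]; first by rewrite !big_nil measure0.
rewrite !big_cons (le_trans (measureU2 _ _ _))//.
  exact: bigsetU_measurable.
by rewrite leeD2l.
Qed.

(** Borel-Cantelli, with summability given as a bound on real partial sums; the exceptional null set
    is the limit superior. *)
Lemma ae_eventually_notin (A : nat -> set T) (C : R) :
  (forall n, measurable (A n)) ->
  (forall n, \sum_(0 <= i < n) fine (P (A i)) <= C) ->
  {ae P, forall w, exists N, forall n, (N <= n)%N -> ~ A n w}.
Proof.
move=> mA sumA.
exists (lim_sup_set A); split.
- by apply: bigcap_measurable => // n _; apply: bigcup_measurable.
- apply: lim_sup_set_cvg0 => //.
  apply: (@le_lt_trans _ _ C%:E); last by rewrite ltry.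
  apply: lime_le; first by apply: is_cvg_nneseries.
  apply: nearW => n /=.
  rewrite (eq_bigr (fun i => (fine (P (A i)))%:E)).
    by rewrite sumEFin lee_fin.
  by move=> i _; rewrite fineK// fin_num_measure.
- move=> w /= /forallNP nA n _.
  have /existsNP[j /not_implyP[nj /contrapT Aj]] := nA n.
  by exists j.
Qed.
End Negligible.

(** * Union bound over the possible embeddings of a finite graph *)

Section Attachment.
Context (d : measure_display) (T : measurableType d) (R : realType).
Variables (P : probability T R) (m : nat) (U : nat * nat -> {RV P >-> nat}).
Hypothesis Uua : uniform_attachment m U.

Let J := [set k : nat * nat | (2 <= k.1)%N && (1 <= k.2 <= m)%N].

(** Carries independence from finite sets of keys over to injective finite families, the form met
    both for the edges of an embedding and for pairs of choices. *)
Lemma attachment_indep (I : finType) (key : I -> nat * nat) (B : I -> set nat) :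
  injective key -> (forall i, J (key i)) ->
  P (\bigcap_(i in setT) (U (key i) @^-1` B i)) =
  (\prod_i P (U (key i) @^-1` B i))%E.
Proof.
move=> ikey Jkey; have [_ _ ind] := Uua.
pose s := [fset key i | i in I]%fset.
pose B' (k : nat * nat) := [set x | exists2 i, key i = k & B i x].
have B'E i : B' (key i) = B i.
  apply/seteqP; split=> x /=; last by exists i.
  by move=> [i' /ikey ->].
have := ind s B'; rewrite (_ : \bigcap_(k in _) _ =
    \bigcap_(i in setT) (U (key i) @^-1` B i)); last first.
  apply/seteqP; split => w /= h.
    by move=> i _; rewrite -B'E; apply: (h (key i)); rewrite /= in_imfset.
  by move=> _ /imfsetP[i _ ->]; rewrite /= B'E; exact: h.
move=> ->//; last first.
  by move=> _ /imfsetP[i _ ->]; exact: Jkey.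
rewrite big_imfset/=; last by move=> x y _ _; exact: ikey.
by rewrite big_enum; apply: eq_bigr => i _; rewrite B'E.
Qed.


(** The probability is [1/(j-1) <= 2/j] for [j >= 2]. The second form matches the edge factors in
    [prod_edges_le]. *)
Lemma attachment_key_prob k i : J k -> (1 <= i < k.1)%N ->
  (P (U k @^-1` [set i]) <= (2 * k.1%:R^-1)%:E)%E.
Proof.
move=> Jk ik; have [_ uni _] := Uua; rewrite uni// lee_fin.
have k2 : (2 <= k.1)%N by case/andP: Jk.
have -> : 2 * k.1%:R^-1 = (k.1%:R / 2)^-1 :> R by rewrite invfM invrK mulrC.
rewrite lef_pV2 ?posrE ?ltr0n ?divr_gt0 ?ltr0n//; [|lia|lia].
rewrite ler_pdivrMr// -natrM ler_nat; lia.
Qed.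

Section FiniteGraphCopies.
Variables (VT ET : finType) (s t : ET -> VT).
Hypothesis VT0 : (0 < #|VT|)%N.
Hypothesis prod_vertices : forall (F : VT -> nat) v0, (forall v, (1 <= F v)%N) ->
  (\prod_v (F v)%:R) * (F v0)%:R <= \prod_e (maxn (F (s e)) (F (t e)))%:R :> R.

(** An edge is chosen by its younger end: [key] is the choice that must produce the image of [e],
    and [low] the value it must take. *)
Let key (F : VT -> nat) (L : ET -> nat) e := (maxn (F (s e)) (F (t e)), L e).
Let low (F : VT -> nat) e := minn (F (s e)) (F (t e)).

(** Injective keys mean that distinct edges are governed by distinct, hence independent, choices.
    Labellings [F] may repeat values at non-adjacent vertices, which only enlarges the union bound
    and lets its sum factor over the vertices. *)
Definition admissible F L := [/\ forall v, (1 <= F v)%N,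
  forall e, F (s e) <> F (t e), injective (key F L)
  & forall e, (1 <= L e <= m)%N].

Definition embedding_event F L : set T :=
  [set w | admissible F L /\ forall e, U (key F L e) w = low F e].

Lemma embedding_eventE F L : admissible F L -> embedding_event F L =
  \bigcap_(e in setT) (U (key F L e) @^-1` [set low F e]).
Proof.
move=> a; apply/seteqP; split => w /=; first by move=> [_ h] e _; exact: h.
by move=> h; split=> // e; exact: h.
Qed.

Lemma embedding_event0 F L : ~ admissible F L -> embedding_event F L = set0.
Proof. by move=> na; apply/seteqP; split => w // []. Qed.

Lemma measurable_embedding_event F L : measurable (embedding_event F L).
Proof.
have [a|/embedding_event0->//] := pselect (admissible F L).
rewrite embedding_eventE//; apply: fin_bigcap_measurable; first exact: finite_finset.
by move=> e _; rewrite -[_ @^-1` _]setTI; exact: measurable_funP.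
Qed.

(** Independence gives a product over the edges, at the price of a factor 2 per edge;
    [prod_edges_le] turns it into a product over the vertices. *)
Lemma embedding_event_prob F L :
  fine (P (embedding_event F L)) <=
    2 ^+ #|ET| * \prod_v vertex_weight R #|VT| (F v).
Proof.
have [a|/embedding_event0->] := pselect (admissible F L); last first.
  by rewrite measure0 mulr_ge0// prodr_ge0// => v _; exact: vertex_weight_ge0.
have [F1 Fst ikey L1] := a.
have Jkey e : J (key F L e).
  rewrite /J /key /= L1 andbT.
  by have := Fst e; have := F1 (s e); have := F1 (t e); lia.
rewrite embedding_eventE// (attachment_indep (fun e => [set low F e]))//.
rewrite (eq_bigr (fun e => (fine (P (U (key F L e) @^-1` [set low F e])))%:E)); last first.
  by move=> e _; rewrite fineK// fin_num_measure// -[_ @^-1` _]setTI; exact: measurable_funP.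
rewrite prodEFin /=.
apply: (@le_trans _ _ (\prod_e (2 * (maxn (F (s e)) (F (t e)))%:R^-1))).
  apply: ler_prod => e _; rewrite fine_ge0//=.
  rewrite -lee_fin fineK ?fin_num_measure//; last first.
    by rewrite -[_ @^-1` _]setTI; exact: measurable_funP.
  apply: (attachment_key_prob (Jkey e)).
  rewrite /low /key/=.
  by have := Fst e; have := F1 (s e); have := F1 (t e); lia.
rewrite big_split /= prodr_const cardT -cardE ler_wpM2l//.
by apply: prod_edges_le => // v0; exact: prod_vertices.
Qed.

(** Expand both powers as sums over functions: the second one runs over the functions avoiding the
    value [N]. The right side telescopes in [N]. *)
Lemma sum_vertex_weight_prod N :
  \sum_(F : {ffun VT -> 'I_N.+1} | [exists v, F v == N :> nat])
      \prod_v vertex_weight R #|VT| (F v) =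
  (\sum_(0 <= i < N.+1) vertex_weight R #|VT| i) ^+ #|VT| -
  (\sum_(0 <= i < N) vertex_weight R #|VT| i) ^+ #|VT|.
Proof.
set q := vertex_weight R #|VT|.
have E1 : (\sum_(0 <= i < N.+1) q i) ^+ #|VT| =
    \sum_(F : {ffun VT -> 'I_N.+1}) \prod_v q (F v).
  rewrite -(bigA_distr_bigA (fun _ (i : 'I_N.+1) => q i)) /= prodr_const.
  by rewrite big_mkord.
have E2 : (\sum_(0 <= i < N) q i) ^+ #|VT| =
    \sum_(F : {ffun VT -> 'I_N.+1} | ~~ [exists v, F v == N :> nat]) \prod_v q (F v).
  rewrite (_ : \sum_(0 <= i < N) q i = \sum_(i < N.+1 | (i < N)%N) q i); last first.
    rewrite big_mkord (big_ord_widen_cond N.+1 predT q (leqnSn N)).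
    by [].
  transitivity (\prod_(v : VT) \sum_(i < N.+1 | (i < N)%N) q i).
    by rewrite prodr_const.
  rewrite (bigA_distr_big _ (fun _ (i : 'I_N.+1) => q i)).
  apply: eq_bigl => F; rewrite negb_exists; apply/ffun_onP/forallP => h v.
    by have /= Fv : (F v < N)%N := h v; rewrite neq_ltn Fv.
  by rewrite unfold_in ltn_neqAle h -ltnS ltn_ord.
rewrite E1 E2 [X in _ = X - _](bigID
  (fun F : {ffun VT -> 'I_N.+1} => [exists v, F v == N :> nat]))/=.
by rewrite addrK.
Qed.

(** [A N] is the event that some embedding with largest vertex label exactly [N] occurs. The bounds
    on the probabilities of these events telescope to a power of a bounded partial sum, so
    Borel-Cantelli applies. *)
Lemma finitely_many_embeddings :
  {ae P, forall w, exists N, forall F L, embedding_event F L w ->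
    forall v, (F v <= N)%N}.
Proof.
pose B N (FL : {ffun VT -> 'I_N.+1} * {ffun ET -> 'I_m.+1}) : set T :=
  if [exists v, FL.1 v == N :> nat]
  then embedding_event (fun v => FL.1 v) (fun e => FL.2 e) else set0.
pose A N : set T := \bigcup_(FL in setT) B N FL.
have mB N FL : measurable (B N FL).
  by rewrite /B; case: ifP => // _; exact: measurable_embedding_event.
have mA N : measurable (A N).
  by apply: fin_bigcup_measurable; [exact: finite_finset|].
pose Q N := \sum_(0 <= i < N) vertex_weight R #|VT| i.
pose K : R := #|{ffun ET -> 'I_m.+1}|%:R * 2 ^+ #|ET|.
have PA N : fine (P (A N)) <= K * (Q N.+1 ^+ #|VT| - Q N ^+ #|VT|).
  have := @Boole_finType _ _ _ P _ (B N) (A N) (mB N) (mA N).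
  have BA w : A N w -> exists FL, B N FL w by move=> [FL _ Bw]; exists FL.
  move=> /(_ BA) PA.
  rewrite -lee_fin fineK ?fin_num_measure// (le_trans PA)//.
  rewrite (eq_bigr (fun FL => (fine (P (B N FL)))%:E)); last first.
    by move=> FL _; rewrite fineK// fin_num_measure.
  rewrite sumEFin lee_fin.
  rewrite -(pair_bigA _ (fun F L => fine (P (B N (F, L))))) /=.
  rewrite -sum_vertex_weight_prod mulr_sumr [leRHS]big_mkcond /=.
  apply: ler_sum => F _; rewrite /B/=.
  case: ifP => _; last by rewrite big1// => i _; rewrite measure0.
  apply: le_trans (ler_sum _ (fun (L : {ffun ET -> 'I_m.+1}) _ =>
    embedding_event_prob (fun v => F v) (fun e => L e))) _.
  by rewrite sumr_const /K -mulrA mulr_natl.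
have sumPA n : \sum_(0 <= i < n) fine (P (A i)) <= K * (1 + #|VT|%:R) ^+ #|VT|.
  rewrite (le_trans (ler_sum _ (fun i _ => PA i)))// -mulr_sumr telescope_sumr//.
  rewrite ler_wpM2l ?mulr_ge0//.
  rewrite [X in _ - X ^+ _]/Q big_geq// expr0n eqn0Ngt VT0 subr0.
  rewrite lerXn2r ?nnegrE ?addr_ge0 ?sumr_ge0 ?sum_vertex_weight_le//.
  by move=> i _; exact: vertex_weight_ge0.
apply: filterS (ae_eventually_notin mA sumPA) => w [N hN]; exists N => F L Ew v.
rewrite leqNgt; apply/negP => NF.
(* The label [M > N] is attained, so the embedding would make the excluded event [A M] occur. *)
pose M := \max_v F v.
have FM u : (F u <= M)%N by exact: leq_bigmax.
have [[F1 _ _ L1] _] := Ew.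
apply: (hN M); first by rewrite (leq_trans (ltnW NF)).
pose F' : {ffun VT -> 'I_M.+1} := [ffun v => inord (F v)].
pose L' : {ffun ET -> 'I_m.+1} := [ffun e => inord (L e)].
have FE : (fun v => F' v : nat) = F.
  by apply/funext => u; rewrite ffunE inordK// ltnS.
have LE : (fun e => L' e : nat) = L.
  by apply/funext => e; rewrite ffunE inordK// ltnS; case/andP: (L1 e).
exists (F', L') => //.
rewrite /B /= FE LE.
rewrite ifT//; apply/existsP.
have [u _ uM] := @eq_bigmax_cond _ predT F VT0.
by exists u; rewrite -[nat_of_ord _]/((fun v => F' v : nat) u) FE /M uM.
Qed.

End FiniteGraphCopies.
End Attachment.

(** * Second moments and interpolation *)

Section SecondMoment.
Context (d : measure_display) (T : measurableType d) (R : realType).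
Variables (P : probability T R) (I : eqType) (A : I -> set T).
Hypothesis mA : forall i, measurable (A i).
Let p i : R := fine (P (A i)).

Definition indep_pair i j := P (A i `&` A j) = (P (A i) * P (A j))%E.

Lemma Lfun_indic (B : set T) : measurable B -> (\1_B : T -> R) \in Lfun P 2%:E.
Proof.
move=> mB; rewrite inE /=; apply/andP; split; rewrite inE//=.
rewrite /finite_norm unlock poweR_lty//.
apply: integrable_lty => //.
rewrite (_ : (fun x => _) = EFin \o \1_B); last first.
  apply/funext => x /=; rewrite indicE; case: (x \in B) => /=.
    by rewrite normr1 powR1.
  by rewrite normr0 powR0.
exact: integrable_indic.
Qed.

Lemma covariance_indic i j : indep_pair i j ->
  covariance P (\1_(A i)) (\1_(A j)) = 0%E.
Proof.
move=> ij.
have Pfin : P setT \is a fin_num := fin_num_measure P _ measurableT.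
have L1 k := Lfun_subset12 Pfin (Lfun_indic (mA k)).
rewrite covarianceE ?L1//; last first.
  by rewrite Lfun2_mul_Lfun1// Lfun_indic.
rewrite (_ : (\1_(A i) * \1_(A j))%R = \1_(A i `&` A j)); last by rewrite indicI.
rewrite !expectation_indic//; last exact: measurableI.
by rewrite [X in (X - _)%E]ij subee// fin_numM// fin_num_measure.
Qed.

Let S (s : seq I) : T -> R := fun w => \sum_(i <- s) \1_(A i) w.

Let S_cons i s : S (i :: s) = (\1_(A i) \+ S s).
Proof. by apply/funext => w; rewrite /S big_cons. Qed.

Let S_nil : S [::] = cst 0.
Proof. by apply/funext => w; rewrite /S big_nil. Qed.

Let Lfun_S s : S s \in Lfun P 2%:E.
Proof.
elim: s => [|i s IH]; first by rewrite S_nil Lfun_cst.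
by rewrite S_cons rpredD ?IH ?lee1n// => ?; exact: Lfun_indic.
Qed.

Let covariance_S i s : (forall j, j \in s -> indep_pair i j) ->
  covariance P (\1_(A i)) (S s) = 0%E.
Proof.
elim: s => [|j s IH] h; first by rewrite S_nil covariance_cst_r.
rewrite S_cons covarianceDr ?Lfun_indic//.
rewrite IH ?adde0 ?covariance_indic//; first by apply: h; rewrite mem_head.
by move=> k ks; apply: h; rewrite inE ks orbT.
Qed.

Let expectation_S s : ('E_P[S s] = (\sum_(i <- s) p i)%:E)%E.
Proof.
have Pfin : P setT \is a fin_num := fin_num_measure P _ measurableT.
elim: s => [|i s IH]; first by rewrite S_nil expectation_cst big_nil.
rewrite S_cons expectationD; last 2 first.
- by apply: Lfun_subset12 => //; exact: Lfun_indic.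
- exact: Lfun_subset12.
by rewrite IH big_cons EFinD expectation_indic// fineK// fin_num_measure.
Qed.

Let variance_indic i : ('V_P[\1_(A i)] <= (p i)%:E)%E.
Proof.
rewrite varianceE ?Lfun_indic//.
rewrite (_ : \1_(A i) ^+ 2 = \1_(A i)); last first.
  by rewrite -[in RHS](setIid (A i)) indicI.
rewrite expectation_indic// leeBlDr ?fin_numX ?fin_num_measure//.
rewrite fineK ?fin_num_measure// leeDl//.
by rewrite expe_ge0.
Qed.

Let variance_S s : uniq s ->
  {in s &, forall i j, i != j -> indep_pair i j} ->
  ('V_P[S s] <= (\sum_(i <- s) p i)%:E)%E.
Proof.
elim: s => [ | i s IH]; first by rewrite S_nil variance_cst big_nil.
move=> /= /andP[nis us] h.
rewrite S_cons varianceD ?Lfun_indic// covariance_S ?mule0 ?adde0.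
  rewrite big_cons EFinD leeD ?variance_indic ?IH//.
  by move=> a b sa sb; apply: h; rewrite inE ?sa ?sb orbT.
move=> j js; apply: h; rewrite ?mem_head ?inE ?js ?orbT//.
by apply: contraNneq nis => ->.
Qed.

(** Chebyshev: for pairwise independent events the covariances vanish, and each indicator has
    variance [p - p^2 <= p], so the variance is at most the mean. *)
Lemma sum_indic_deviation (s : seq I) (e : R) : 0 < e -> uniq s ->
  {in s &, forall i j, i != j -> indep_pair i j} ->
  fine (P [set w | e <= `|\sum_(i <- s) \1_(A i) w - \sum_(i <- s) p i|])
    <= (\sum_(i <- s) p i) / e ^+ 2.
Proof.
move=> e0 us ind.
have mS : measurable_fun setT (S s).
  by have /andP[mS _] := Lfun_S s; exact: set_mem mS.
pose f : {RV P >-> R} := mfun_Sub (mem_set mS).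
have := chebyshev f e0.
rewrite [f : T -> R]/= expectation_S/= => H.
rewrite -lee_fin fineK ?fin_num_measure//; last first.
  have mD : measurable_fun setT (fun w => `|S s w - \sum_(i <- s) p i|).
    by apply: measurableT_comp => //; exact: measurable_funB.
  rewrite (_ : [set _ | _] = setT `&`
    (fun w => `|S s w - \sum_(i <- s) p i|) @^-1` [set` `[e, +oo[%R]).
    by apply: mD => //; exact: measurable_itv.
  by apply/seteqP; split => w /=; rewrite in_itv/= andbT; [split|case].
rewrite (le_trans H)// mulrC EFinM lee_wpmul2l ?lee_fin ?invr_ge0 ?exprn_ge0 ?(ltW e0)//.
exact: variance_S.
Qed.
End SecondMoment.

(** * Harmonic sums and the logarithm *)

Section Harmonic.
Variable R : realType.

(** Each dyadic block contributes at most 1. *)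
Lemma sum_inv_pow2_le K : \sum_(1 <= i < 2 ^ K) (i%:R^-1 : R) <= K%:R.
Proof.
elim: K => [|K IH]; first by rewrite big_geq.
have K0 : (0 < 2 ^ K)%N by rewrite expn_gt0.
rewrite (@big_cat_nat _ _ _ (2 ^ K))//=; last by rewrite leq_exp2l.
rewrite -natr1 lerD//.
apply: (@le_trans _ _ (\sum_(2 ^ K <= i < 2 ^ K.+1) ((2 ^ K)%:R^-1 : R))).
  rewrite !big_nat; apply: ler_sum => i /andP[Ki _].
  by rewrite lef_pV2 ?posrE ?ltr0n ?ler_nat// (leq_trans K0).
rewrite sumr_const_nat expnS mul2n -addnn addnK -(mulr_natl (_^-1)) mulfV ?pnatr_eq0// -?lt0n//.

Qed.

Lemma lnS n : (0 < n)%N -> ln (n.+1%:R : R) = ln n%:R + ln (1 + n%:R^-1).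
Proof.
move=> n0; have n0' : (0 : R) < n%:R by rewrite ltr0n.
rewrite -lnM ?posrE ?addr_gt0 ?invr_gt0//; congr ln.
by rewrite mulrDr mulr1 mulfV ?gt_eqF// -natr1.
Qed.

Lemma ln_le_sum_inv n : (0 < n)%N ->
  ln n%:R <= \sum_(1 <= i < n) (i%:R^-1 : R).
Proof.
case: n => // n _; elim: n => [|n IH]; first by rewrite big_geq// ln1.
rewrite big_nat_recr//= lnS// lerD// le_ln1Dx//.
by rewrite (lt_le_trans (ltrN10 _))// invr_ge0.
Qed.

Lemma sum_inv_le_ln n : (0 < n)%N ->
  \sum_(1 <= i < n) (i%:R^-1 : R) <= 1 + ln n%:R.
Proof.
move=> n0; suff : \sum_(1 <= i < n.+1) (i%:R^-1 : R) <= 1 + ln n%:R.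
  by apply: le_trans; rewrite [leRHS]big_nat_recr//= lerDl invr_ge0.
case: n n0 => // n _; elim: n => [|n IH]; first by rewrite big_nat1 ln1 addr0 invr1.
rewrite big_nat_recr//= lnS// addrA lerD// -lerN2.
(* Writing the increment of [ln] as [-ln (1 - 1/(n+2))] makes the upper bound [ln (1 + x) <= x]
   yield a lower bound. *)
have n1 : 1 + n.+1%:R^-1 = (1 - n.+2%:R^-1)^-1 :> R.
  rewrite -(natr1 n.+1); have : (0 : R) < n.+1%:R by rewrite ltr0n.
  move: n.+1%:R => N N0; field; lra.
have n2 : (n.+2%:R^-1 : R) < 1 by rewrite invf_lt1 ?ltr0n// ltr1n.
rewrite n1 lnV ?posrE ?subr_gt0// opprK; apply: le_ln1Dx.
by rewrite ltrN2.
Qed.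

Lemma sum_inv_sqr_le n : \sum_(0 <= i < n) (i.+1%:R ^- 2 : R) <= 2.
Proof.
(* The strengthened bound closes the induction, with slack [1/((n+1)(n+2)^2)]. *)
suff: \sum_(0 <= i < n.+1) (i.+1%:R ^- 2 : R) <= 2 - n.+1%:R^-1.
  move=> h; apply: le_trans (le_trans h _).
    by rewrite [leRHS]big_nat_recr//= lerDl invr_ge0 exprn_ge0.
  by rewrite gerBl invr_ge0.
elim: n => [|n IH]; first by rewrite big_nat1 expr1n invr1 (_ : 2 - 1 = 1 :> R)//; ring.
rewrite big_nat_recr//=; apply: le_trans (lerD IH (lexx _)) _.
rewrite -subr_ge0.
rewrite (_ : _ - _ = (n.+1%:R * n.+2%:R ^+ 2)^-1 :> R) ?invr_ge0 ?mulr_ge0 ?exprn_ge0//.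
rewrite -(natr1 n.+1); have : (0 : R) < n.+1%:R by rewrite ltr0n.
by move: n.+1%:R => N N0; field; lra.
Qed.
End Harmonic.

(** * From the subsequence [2^((k+1)^2)] to all [n] *)

Section Interpolation.
Variable R : realType.

Lemma squares_bracket K n : (2 ^ (K.+1 ^ 2) <= n)%N ->
  exists2 k, (K <= k)%N & (2 ^ (k.+1 ^ 2) <= n < 2 ^ (k.+2 ^ 2))%N.
Proof.
move=> Kn.
have ub k : (2 ^ (k.+1 ^ 2) <= n)%N -> (k <= n)%N.
  move=> h; apply: leq_trans h; apply: (@leq_trans (2 ^ k)).
    by rewrite ltnW// ltn_expl.
  rewrite leq_exp2l//; nia.
case: (ex_maxnP (ex_intro _ K Kn) ub) => k kn kmax; exists k.
  exact: kmax.
by rewrite kn ltnNge; apply/negP => /kmax; rewrite ltnn.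
Qed.

(* For [2^((k+1)^2) <= n < 2^((k+2)^2)] monotonicity encloses [D n / ln n]
   between two multiples of the values at the ends, with ratio
   [((k+2)/(k+1))^4 --> 1]. *)
Lemma cvg_div_ln (D : nat -> R) (L : R) : (forall n, 0 <= D n) ->
  {homo D : i j / (i <= j)%N >-> i <= j} ->
  D (2 ^ (k.+1 ^ 2))%N / (k.+1 ^ 2)%:R @[k --> \oo] --> L * ln 2 ->
  D n / ln n%:R @[n --> \oo] --> L.
Proof.
move=> D0 Dmono DL.
have ln2 : 0 < ln 2 :> R by rewrite ln_gt0// ltr1n.
pose u k := D (2 ^ (k.+1 ^ 2))%N / (k.+1 ^ 2)%:R.
(* As [harmonic k] is [1/(k+1)], the squared corrections are [((k+1)/(k+2))^2] in [a] and
   [((k+2)/(k+1))^2] in [b]; they exchange the denominators of the two ends of the block. *)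
pose a k := u k * ((1 - harmonic k.+1) ^+ 2) / ln 2.
pose b k := u k.+1 * ((1 + harmonic k) ^+ 2) / ln 2.
have LE : L = L * ln 2 * 1 ^+ 2 / ln 2 by rewrite expr1n mulr1 mulfK// gt_eqF.
have h0 : @harmonic R k @[k --> \oo] --> (0 : R) := @cvg_harmonic R.
have h1 : @harmonic R k.+1 @[k --> \oo] --> (0 : R).
  by have := h0; rewrite -(cvg_shiftS (@harmonic R)).
have aL : a k @[k --> \oo] --> L.
  rewrite [X in _ --> X]LE; apply: cvgMl; apply: cvgM => //.
  have : (1 - @harmonic R k.+1) @[k --> \oo] --> (1 - 0 : R) by apply: cvgB h1; exact: cvg_cst.
  by rewrite subr0 => h; exact: (cvgM h h).
have bL : b k @[k --> \oo] --> L.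
  rewrite [X in _ --> X]LE; apply: cvgMl; apply: cvgM => //.
    by have := DL; rewrite -(cvg_shiftS u).
  have : (1 + @harmonic R k) @[k --> \oo] --> (1 + 0 : R) by apply: cvgD h0; exact: cvg_cst.
  by rewrite addr0 => h; exact: (cvgM h h).
have lnE k : ln (2 ^ (k ^ 2))%:R = (k ^ 2)%:R * ln 2 :> R.
  by rewrite natrX lnXn ?ltr0n// mulr_natl.
have enclosed k n : (2 ^ (k.+1 ^ 2) <= n < 2 ^ (k.+2 ^ 2))%N ->
    a k <= D n / ln n%:R <= b k.
  move=> /andP[kn nk].
  have n0 : (0 < n)%N by apply: leq_trans kn; rewrite expn_gt0.
  have l1 : (k.+1 ^ 2)%:R * ln 2 <= ln n%:R :> R.
    by rewrite -lnE ler_ln ?posrE ?ltr0n ?expn_gt0// ler_nat.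
  have l2 : ln n%:R <= (k.+2 ^ 2)%:R * ln 2 :> R.
    by rewrite -lnE ler_ln ?posrE ?ltr0n ?expn_gt0// ler_nat ltnW.
  have k1 : 0 < (k.+1 ^ 2)%:R * ln 2 :> R by rewrite mulr_gt0// ltr0n expn_gt0.
  have lnn : 0 < ln n%:R :> R by apply: lt_le_trans l1.
  have aE : a k = D (2 ^ (k.+1 ^ 2))%N / ((k.+2 ^ 2)%:R * ln 2).
    rewrite /a /u /harmonic /= !natrX.
    have : (0 : R) < k.+1%:R by rewrite ltr0n.
    rewrite -(natr1 k.+1); move: k.+1%:R => N N0; field.
    by rewrite gt_eqF//=; lra.
  have bE : b k = D (2 ^ (k.+2 ^ 2))%N / ((k.+1 ^ 2)%:R * ln 2).
    rewrite /b /u /harmonic /= !natrX.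
    have : (0 : R) < k.+1%:R by rewrite ltr0n.
    rewrite -(natr1 k.+1); move: k.+1%:R => N N0; field.
    by rewrite gt_eqF//=; lra.
  rewrite aE bE; apply/andP; split; apply: ler_pM => //; rewrite ?invr_ge0 ?(ltW lnn) ?(ltW k1)//.
  - by rewrite mulr_ge0// ltW.
  - exact: Dmono.
  - by rewrite lef_pV2 ?posrE// (lt_le_trans lnn).
  - by apply: Dmono; rewrite ltnW.
  - by rewrite lef_pV2 ?posrE.
apply/cvgrPdist_lt => e e0.
move/cvgrPdist_lt : aL => /(_ e e0) [Ka _ Ha].
move/cvgrPdist_lt : bL => /(_ e e0) [Kb _ Hb].
exists (2 ^ ((maxn Ka Kb).+1 ^ 2))%N => // n /= /squares_bracket[k].
rewrite geq_max => /andP[/Ha /= ak /Hb /= bk] /enclosed/andP[y1 y2].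
move: ak bk; rewrite !ltr_distl => /andP[_ x1] /andP[x2 _]; apply/andP.
by split; lra.
Qed.
End Interpolation.

(** * Degrees *)

Definition younger_keys (m x n : nat) : seq (nat * nat) :=
  [seq (j, a) | j <- index_iota x.+1 n.+1, a <- index_iota 1 m.+1].

Lemma mem_younger_keys m x n k :
  (k \in younger_keys m x n) = (x < k.1 <= n)%N && (1 <= k.2 <= m)%N.
Proof.
case: k => j a; apply/allpairsP/idP => /=.
  by move=> [[j' a'] /= []]; rewrite !mem_index_iota !ltnS => j1 a1 [-> ->]; rewrite j1 a1.
move=> /andP[h1 h2]; exists (j, a).
by rewrite !mem_index_iota !ltnS h1 h2.
Qed.

Lemma uniq_younger_keys m x n : uniq (younger_keys m x n).
Proof. by apply: allpairs_uniq; [exact: iota_uniq|exact: iota_uniq|move=> [? ?] [? ?]]. Qed.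

(** The edges that [x] sends to older vertices are left out, so this is a sum of independent
    indicators; it differs from the degree of [x] by a bounded amount. *)
Definition younger_degree (T : Type) (m : nat) (U : nat * nat -> T -> nat)
    (x n : nat) (w : T) : nat :=
  count (fun k => U k w == x) (younger_keys m x n).

Section Degree.
Context (d : measure_display) (T : measurableType d) (R : realType).
Variables (P : probability T R) (m : nat) (U : nat * nat -> {RV P >-> nat}).
Hypothesis Uua : uniform_attachment m U.

Variable x : nat.
Hypothesis x0 : (1 <= x)%N.

Let A k : set T := U k @^-1` [set x].
Let mA k : measurable (A k).
Proof. by rewrite -[A k]setTI; exact: measurable_funP. Qed.

Let degE n w : (younger_degree m U x n w)%:R =
  \sum_(k <- younger_keys m x n) \1_(A k) w :> R.
Proof.
rewrite /younger_degree -sum1_count natr_sum big_mkcond /=.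
apply: eq_bigr => k _; rewrite indicE /A.
by case: eqVneq => /= [h|/eqP h]; [rewrite mem_set|rewrite memNset].
Qed.

Let meanE n : \sum_(k <- younger_keys m x n) fine (P (A k)) =
  m%:R * \sum_(x <= i < n) (i%:R^-1 : R).
Proof.
have [_ uni _] := Uua.
transitivity (\sum_(k <- younger_keys m x n) (k.1.-1%:R^-1 : R)).
  rewrite !big_seq; apply: eq_bigr => -[j a]; rewrite mem_younger_keys /= => /andP[j1 a1].
  have Jk : (2 <= (j, a).1)%N && (1 <= (j, a).2 <= m)%N by rewrite /= a1 andbT; lia.
  by rewrite (uni _ Jk)//= x0; case/andP: j1.
(* Put [i = j - 1]; the [m] labels of [j] contribute equally. *)
rewrite big_allpairs_dep /= big_add1 /= mulr_sumr; apply: eq_bigr => i _.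
by rewrite sumr_const_nat subn1 /= mulr_natl.
Qed.

Let indep n : {in younger_keys m x n &, forall i j, i != j -> indep_pair P A i j}.
Proof.
move=> [i1 i2] [j1 j2]; rewrite !mem_younger_keys /= => iJ jJ ij.
pose key (b : bool) := if b then (i1, i2) else (j1, j2).
have ikey : injective key.
  by move=> [] [] // /eqP; rewrite ?(negbTE ij)// eq_sym (negbTE ij).
have Jkey b : (2 <= (key b).1)%N && (1 <= (key b).2 <= m)%N by case: b => /=; lia.
have := attachment_indep Uua (fun=> [set x]) ikey Jkey.
rewrite big_bool /= /indep_pair /A => <-; congr (P _).
apply/seteqP; split => w /=; first by move=> [h1 h2] [].
by move=> h; split; [exact: (h true)|exact: (h false)].
Qed.

Lemma sum_inv_tail_bounds n : (x <= n)%N ->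
  ln n%:R - \sum_(1 <= i < x) (i%:R^-1 : R) <=
    \sum_(x <= i < n) (i%:R^-1 : R) <= 1 + ln n%:R.
Proof.
move=> xn.
have n0 : (0 < n)%N by exact: leq_trans xn.
have := @ln_le_sum_inv R n n0; have := @sum_inv_le_ln R n n0.
rewrite (@big_cat_nat _ _ _ x)//=.
have : 0 <= \sum_(1 <= i < x) (i%:R^-1 : R) by apply: sumr_ge0.
by move=> *; apply/andP; split; lra.
Qed.

Let M k : R := m%:R * \sum_(x <= i < 2 ^ (k.+1 ^ 2)) (i%:R^-1 : R).
Let D k w : R := (younger_degree m U x (2 ^ (k.+1 ^ 2)) w)%:R.

(** At [n = 2^((k+1)^2)] the mean, hence the variance, is at most [m (k+1)^2]. Chebyshev then bounds
    the probability by [m / (e^2 (k+1)^2)], which is summable. *)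
Lemma degree_deviation (e : R) : 0 < e ->
  {ae P, forall w, exists N, forall k, (N <= k)%N ->
     `|D k w - M k| < e * (k.+1 ^ 2)%:R}.
Proof.
move=> e0.
pose B k : set T := [set w | e * (k.+1 ^ 2)%:R <= `|D k w - M k|].
have k0 k : 0 < e * (k.+1 ^ 2)%:R by rewrite mulr_gt0// ltr0n expn_gt0.
have mB k : measurable (B k).
  have mD : measurable_fun setT (fun w => `|D k w - M k|).
    apply: measurableT_comp => //; apply: measurable_funB => //.
    rewrite (_ : D k = fun w => \sum_(i <- younger_keys m x (2 ^ (k.+1 ^ 2))) \1_(A i) w).
      by apply: measurable_sum => i; exact: measurable_indic.
    by apply/funext => w; exact: degE.
  rewrite (_ : B k = setT `&`
    (fun w => `|D k w - M k|) @^-1` [set` `[e * (k.+1 ^ 2)%:R, +oo[%R]).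
    by apply: mD => //; exact: measurable_itv.
  by apply/seteqP; split => w /=; rewrite in_itv/= andbT; [split|case].
have PB k : fine (P (B k)) <= m%:R / e ^+ 2 * k.+1%:R ^- 2.
  have := @sum_indic_deviation _ _ _ P _ A mA
    (younger_keys m x (2 ^ (k.+1 ^ 2))) _ (k0 k) (uniq_younger_keys _ _ _) (@indep _).
  rewrite meanE -/(M k) (_ : [set w | _] = B k); last first.
    by apply/seteqP; split => w /=; rewrite -degE.
  move/le_trans; apply.
  apply: (@le_trans _ _ (m%:R * (k.+1 ^ 2)%:R / (e * (k.+1 ^ 2)%:R) ^+ 2)).
    rewrite ler_wpM2r ?invr_ge0 ?exprn_ge0 ?(ltW (k0 k))// ler_wpM2l//.
    apply: le_trans (sum_inv_pow2_le R (k.+1 ^ 2)).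
    have [xn|nx] := leqP x (2 ^ (k.+1 ^ 2)).
      by rewrite [leRHS](@big_cat_nat _ _ _ x)//= lerDr sumr_ge0.
    by rewrite big_geq ?(ltnW nx)// sumr_ge0.
  rewrite natrX le_eqVlt; apply/orP; left; apply/eqP.
  have : (0 : R) < k.+1%:R by rewrite ltr0n.
  by move: k.+1%:R => N N0; field; rewrite !gt_eqF.
have sumPB n : \sum_(0 <= i < n) fine (P (B i)) <= m%:R / e ^+ 2 * 2.
  apply: le_trans (ler_sum _ (fun i _ => PB i)) _.
  by rewrite -mulr_sumr ler_wpM2l ?divr_ge0 ?exprn_ge0 ?(ltW e0)// sum_inv_sqr_le.
apply: filterS (ae_eventually_notin mB sumPB) => w [N hN]; exists N => k Nk.
by rewrite ltNge; apply/negP; exact: hN.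
Qed.

Lemma younger_degree_cvg : {ae P, forall w,
  (younger_degree m U x n w)%:R / ln n%:R @[n --> \oo] --> (m%:R : R)}.
Proof.
(* Countably many tolerances [1/(q+1)] suffice, so one almost sure event serves all of them. *)
have /ae_foralln : forall q : nat, {ae P, forall w, exists N, forall k, (N <= k)%N ->
     `|D k w - M k| < q.+1%:R^-1 * (k.+1 ^ 2)%:R}.
  by move=> q; apply: degree_deviation; rewrite invr_gt0.
apply: filterS => w hw.
apply: (@cvg_div_ln R (fun n => (younger_degree m U x n w)%:R)) => //.
  move=> i j ij; rewrite ler_nat /younger_degree.
  have [xi|ix] := leqP x i; last first.
    by rewrite /younger_keys /index_iota (_ : i.+1 - x.+1 = 0)%N//; lia.
  rewrite /younger_keys /index_iota.
  rewrite (_ : j.+1 - x.+1 = (i.+1 - x.+1) + (j - i))%N; last by lia.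
  by rewrite iotaD allpairs_cat count_cat leq_addr.
have ln2 : 0 < ln 2 :> R by rewrite ln_gt0// ltr1n.
have k20 k : (0 : R) < (k.+1 ^ 2)%:R by rewrite ltr0n expn_gt0.
have h1 : (D k w - M k) / (k.+1 ^ 2)%:R @[k --> \oo] --> (0 : R).
  apply/cvgr0Pnorm_lt => e e0.
  have [q _ /(_ q (leqnn q)) qe] : \forall q \near \oo, @harmonic R q < e.
    by have /cvgr_lt := @cvg_harmonic R; apply.
  have [N hN] := hw q; exists N => // k /= /hN Nk.
  rewrite normrM normfV (gtr0_norm (k20 k)) ltr_pdivrMr// (lt_trans Nk)//.
  by rewrite ltr_pM2r.
(* The harmonic tail is [ln n + O(1)], and [ln n = (k+1)^2 ln 2] along the subsequence. *)
have h2 : M k / (k.+1 ^ 2)%:R @[k --> \oo] --> m%:R * ln 2.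
  rewrite /M; under eq_fun do rewrite -mulrA.
  apply: cvgMr.
  pose K := \sum_(1 <= i < x) (i%:R^-1 : R).
  have hs : (k.+1 ^ 2)%:R^-1 @[k --> \oo] --> (0 : R).
    rewrite (_ : (fun k => _) = fun k => @harmonic R k * @harmonic R k); last first.
      by apply/funext => k; rewrite /harmonic /= natrX expr2 invfM.
    by rewrite -[X in _ --> X](mulr0 0); apply: cvgM; exact: cvg_harmonic.
  apply: (@squeeze_cvgr _ _ _ _ (fun k => ln 2 - K * (k.+1 ^ 2)%:R^-1)
    (fun k => ln 2 + (k.+1 ^ 2)%:R^-1)).
  - exists x => // k /= xk.
    have xn : (x <= 2 ^ (k.+1 ^ 2))%N.
      apply: (leq_trans xk); apply: (@leq_trans (2 ^ k)); first by rewrite ltnW// ltn_expl.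
      rewrite leq_exp2l//; nia.
    have := sum_inv_tail_bounds xn; rewrite natrX lnXn ?ltr0n// -/K => /andP[b1 b2].
    rewrite ler_pdivlMr// ler_pdivrMr// mulrBl mulrDl -mulrA mulVf ?gt_eqF// mulr1.
    by rewrite mulr_natr b1 addrC b2.
  - have : (ln 2 - K * (k.+1 ^ 2)%:R^-1) @[k --> \oo] --> (ln 2 - K * 0 : R).
      by apply: cvgB; [exact: cvg_cst|exact: cvgMr].
    by rewrite mulr0 subr0.
  - have : (ln 2 + (k.+1 ^ 2)%:R^-1) @[k --> \oo] --> (ln 2 + 0 : R).
      by apply: cvgD hs; exact: cvg_cst.
    by rewrite addr0.
rewrite (_ : (fun k => _) =
    (fun k => (D k w - M k) / (k.+1 ^ 2)%:R + M k / (k.+1 ^ 2)%:R)).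
  by rewrite -[X in _ --> X]add0r; exact: cvgD.
by apply/funext => k; rewrite -mulrDl subrK.
Qed.
End Degree.

(** * Multicyclic leaf-free graphs *)

Lemma set_bijP T1 T2 (A : set T1) (B : set T2) (f : T1 -> T2) :
  set_bij A B f <-> [/\ forall x, A x -> B (f x),
    forall x y, A x -> A y -> f x = f y -> x = y
    & forall y, B y -> exists2 x, A x & f x = y].
Proof.
split=> [[fA fI fS]|[fA fI fS]]; split=> //.
- by move=> x y Ax Ay; apply: fI; rewrite inE.
- by move=> x y; rewrite !inE; exact: fI.
Qed.

Lemma set2_eq T (a b c e : T) : [set a; b] = [set c; e] ->
  (a = c /\ b = e) \/ (a = e /\ b = c).
Proof.
move=> E.
have : [set c; e] a by rewrite -E; left.
have : [set c; e] b by rewrite -E; right.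
have : [set a; b] c by rewrite E; left.
have : [set a; b] e by rewrite E; right.
by rewrite /=; intuition congruence.
Qed.

Lemma finite_set_enum (V : Type) (A : set V) : finite_set A ->
  exists n (f : 'I_n -> V), injective f /\ forall x, A x <-> exists i, f i = x.
Proof.
move=> fA; have /finite_seqP[s As] : finite_set (A : set {classic V}) by [].
exists (size (undup s)), (tnth (in_tuple (undup s) : _.-tuple {classic V})); split.
  by apply/(tuple_uniqP (in_tuple (undup s))); exact: (undup_uniq s).
move=> x; have -> : A x = ((x : {classic V}) \in undup s) by rewrite mem_undup As.
split=> [xs|[i <-]]; last exact: mem_tnth.
by have /tnthP[i ->] : (x : {classic V}) \in in_tuple (undup s) by []; exists i.
Qed.

(** [isomorphic] with its two maps named, so that they can be composed and evaluated at a vertex. *)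
Definition iso_by V1 E1 V2 E2 (G1 : mgraph V1 E1) (G2 : mgraph V2 E2)
    (f : V1 -> V2) (g : E1 -> E2) : Prop :=
  [/\ set_bij (verts G1) (verts G2) f, set_bij (edges G1) (edges G2) g
    & forall e, edges G1 e -> ends G2 (g e) = f @` ends G1 e].

(** Vertex maps are arbitrary outside [verts]; closure keeps the ends of edges where an inverse map
    is controlled. *)
Definition closed_mgraph V E (G : mgraph V E) :=
  forall e, edges G e -> ends G e `<=` verts G.

Lemma loopless_closed V E (G : mgraph V E) :
  loopless_multigraph G -> closed_mgraph G.
Proof. by move=> h e /h[x [y [Gx Gy _ ->]]] z [] ->. Qed.

Lemma iso_by_comp V1 E1 V2 E2 V3 E3 (G1 : mgraph V1 E1) (G2 : mgraph V2 E2)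
    (G3 : mgraph V3 E3) f g f' g' :
  iso_by G1 G2 f g -> iso_by G2 G3 f' g' -> iso_by G1 G3 (f' \o f) (g' \o g).
Proof.
move=> [f1 g1 e1] [f2 g2 e2]; split; [exact: set_bij_comp f1 f2|exact: set_bij_comp g1 g2|].
move=> e G1e; have [h _ _] := g1; rewrite /= e2 ?e1 ?image_comp//; exact: h.
Qed.

(** The function argument supplies values of the inverse outside [B]. *)
Lemma set_bij_inverse T1 T2 (A : set T1) (B : set T2) (f : T1 -> T2) :
  (T2 -> T1) -> set_bij A B f ->
  exists f', [/\ set_bij B A f', forall x, A x -> f' (f x) = x
    & forall y, B y -> f (f' y) = y].
Proof.
move=> h /set_bijP[fA fI fS].
have /boolp.choice[f' f'P] : forall y, exists x, B y -> A x /\ f x = y.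
  move=> y.
  have [/fS[x Ax fx]|nBy] := pselect (B y); first by exists x.
  by exists (h y).
have f'K x : A x -> f' (f x) = x.
  by move=> Ax; have [? ?] := f'P _ (fA _ Ax); exact: fI.
exists f'; split=> //; last by move=> y /f'P[].
apply/set_bijP; split.
- by move=> y /f'P[].
- by move=> x y /f'P[_ {2}<-] /f'P[_ {2}<-] ->.
- by move=> x Ax; exists (f x); [exact: fA|exact: f'K].
Qed.

Lemma iso_by_inverse V1 E1 V2 E2 (G1 : mgraph V1 E1) (G2 : mgraph V2 E2) f g :
  (V2 -> V1) -> (E2 -> E1) -> closed_mgraph G1 -> iso_by G1 G2 f g ->
  exists f' g', iso_by G2 G1 f' g' /\ forall x, verts G1 x -> f' (f x) = x.
Proof.
move=> hV hE cl [fb gb e].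
have [f' [f'b f'K fK']] := set_bij_inverse hV fb.
have [g' [g'b g'K gK']] := set_bij_inverse hE gb.
exists f', g'; split=> //; split=> // d G2d.
have [g'd _ _] := g'b.
rewrite -[in RHS](gK' _ G2d) e ?image_comp; last exact: g'd.
apply/seteqP; split => x /=.
  by move=> dx; exists x => //=; apply: f'K; apply: cl dx; exact: g'd.
by move=> [y dy <-] /=; rewrite f'K//; apply: cl dy; exact: g'd.
Qed.

(** * Cycles and degrees in the 2-core, here denoted [H] *)

Section Core.
Variables (V E : Type) (H : mgraph V E).
Hypothesis Hloop : loopless_multigraph H.
Hypothesis Hconn : connected_mgraph H.
Hypothesis Hmulti : multicyclic H.
Hypothesis Hleaf : leaf_free H.

Lemma multicyclic_two_vertices : exists x y, [/\ verts H x, verts H y & x <> y].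
Proof.
have [S1 [_ [[k k2 [[sv _ _] [f [g [/set_bijP[fA fI _] _ _]]]]] _ _]]] := Hmulti.
have k0 : `I_k 0 by rewrite /=; lia.
have k1 : `I_k 1 by rewrite /=; lia.
exists (f 0), (f 1); split; [exact/sv/fA|exact/sv/fA|].
by move=> /fI; move=> /(_ k0 k1).
Qed.

Lemma connected_incident x : verts H x -> exists e, incident H x e.
Proof.
move=> Hx; have [a [b [Ha Hb ab]]] := multicyclic_two_vertices.
have [y Hy xy] : exists2 y, verts H y & x <> y.
  have [xa|xa] := pselect (x = a); last by exists a.
  by exists b => //; rewrite xa.
have [_ /(_ x y Hx Hy)/clos_rt_rt1n_iff c] := Hconn.
case: c xy => // z y' [e He ee] _ _.
by exists e; split=> //; rewrite ee; left.
Qed.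

Lemma two_incident x : verts H x ->
  exists e1 e2, [/\ incident H x e1, incident H x e2 & e1 <> e2].
Proof.
move=> Hx; have [e1 i1] := connected_incident Hx.
apply: contrapT => h; apply: (Hleaf Hx).
rewrite (_ : incident H x = [set e1]); first exact: card_set1.
apply/seteqP; split => e /=; last by move=> ->.
by move=> ie; apply: contrapT => ne; apply: h; exists e, e1.
Qed.

Lemma closed_under_adjacency (A : set V) x :
  A x -> verts H x -> (forall y z, A y -> Defs.adjacent H y z -> A z) ->
  verts H `<=` A.
Proof.
move=> Ax Hx clA y Hy; have [_ /(_ x y Hx Hy)/clos_rt_rtn1_iff] := Hconn.
by elim=> // u z uz _ Au; exact: clA Au uz.
Qed.

(* If every vertex had exactly two incident edges, a cycle would be closed
   under adjacency, hence would be the whole graph. *)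
Lemma three_incident : exists x e1 e2 e3,
  [/\ verts H x, incident H x e1, incident H x e2, incident H x e3
    & [/\ e1 <> e2, e1 <> e3 & e2 <> e3]].
Proof.
apply: contrapT => no3.
have whole S : cycles H S -> S = (verts H, edges H).
  move=> [k k2 [[sv se sc] [f [g [/set_bijP[fA fI fS] /set_bijP[gA gI gS] fg]]]]].
  have all_in x e : S.1 x -> incident H x e -> S.2 e.
    move=> /fS[i ik fix_] ie; apply: contrapT => nSe.
    (* [j] is the predecessor of [i] on the cycle. The cycle edges [g i] and [g j] at [x] differ
       because [k >= 2], so an edge outside the cycle would be a third one at [x]. *)
    pose j := if i is i'.+1 then i' else k.-1.
    have jk : (j < k)%N by rewrite /j; case: (i) ik => /= *; lia.
    have ji : (j.+1 %% k = i)%N.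
      rewrite /j; case: (i) ik => /= [_|i' ik]; last by rewrite modn_small.
      by rewrite prednK ?modnn//; lia.
    have ij : i <> j.
      by rewrite /j; case: (i) ik => /= *; lia.
    have inc l : (l < k)%N -> (i = l \/ i = l.+1 %% k)%N -> incident H x (g l).
      move=> lk il; have := fg l lk => /= El.
      have [_ _ {}sc] := And3 sv se sc; have [E1 _] := sc _ (gA _ lk).
      split; first exact/se/gA.
      by rewrite El; exists i.
    apply: no3; exists x, e, (g i), (g j); split => //.
    - by apply: sv; rewrite -fix_; exact: fA.
    - by apply: inc => //; left.
    - by apply: inc => //; right.
    split.
    - by move=> eg; apply: nSe; rewrite eg; exact: gA.
    - by move=> eg; apply: nSe; rewrite eg; exact: gA.
    - by move=> /gI h; apply: ij; exact: h.
  have k0 : `I_k 0 by rewrite /=; lia.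
  have VS : verts H `<=` S.1.
    apply: (@closed_under_adjacency _ (f 0)); [exact: fA|exact/sv/fA|].
    move=> y z Sy [e He ee].
    have Se : S.2 e by apply: (all_in y) => //; split=> //; rewrite ee; left.
    by have [_] := sc _ Se; apply; rewrite /= ee; right.
  rewrite [S]surjective_pairing; congr pair; apply/seteqP; split=> // e He.
  have [x [y [Hx _ _ ee]]] := Hloop He.
  by apply: (all_in x); [exact: VS|split=> //; rewrite ee; left].
have [S1 [S2 [c1 c2]]] := Hmulti; apply.
by rewrite (whole _ c1) (whole _ c2).
Qed.

Hypothesis Hfin : finite_mgraph H.

(** Enumerates the vertices and edges, orients each edge arbitrarily, and checks the hypotheses of
    [prod_vertices_le]. *)
Lemma finite_graph_model : exists (k l : nat) (v : 'I_k -> V) (e : 'I_l -> E)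
    (s t : 'I_l -> 'I_k),
  [/\ [/\ injective v, forall x, verts H x <-> exists i, v i = x,
      injective e, forall d, edges H d <-> exists j, e j = d
      & forall j, ends H (e j) = [set v (s j); v (t j)]],
    (0 < #|'I_k|)%N
    & forall (R : realType) (F : 'I_k -> nat) v0, (forall i, (1 <= F i)%N) ->
      (\prod_i (F i)%:R) * (F v0)%:R <=
        \prod_j (maxn (F (s j)) (F (t j)))%:R :> R].
Proof.
have [fV fE] := Hfin.
have [k [v [vI vP]]] := finite_set_enum fV.
have [l [e [eI eP]]] := finite_set_enum fE.
have eH j : edges H (e j) by apply/eP; exists j.
have /boolp.choice[st stP] : forall j, exists st : 'I_k * 'I_k,
    st.1 != st.2 /\ ends H (e j) = [set v st.1; v st.2].
  move=> j.
  have [x [y [/vP[a <-] /vP[b <-] ab ->]]] := Hloop (eH j).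
  by exists (a, b); split=> //; apply/eqP => /= abE; apply: ab; rewrite abE.
pose s j := (st j).1; pose t j := (st j).2.
have eE j : ends H (e j) = [set v (s j); v (t j)] by case: (stP j).
have incP i d : incident H (v i) d -> exists2 j, e j = d & (s j == i) || (t j == i).
  move=> [/eP[j <-]]; rewrite eE => h; exists j => //.
  by case: h => /vI ->; rewrite eqxx ?orbT.
exists k, l, v, e, s, t; split=> //.
  have [x [_ [/vP[i _] _ _]]] := multicyclic_two_vertices.
  by rewrite card_ord; exact: leq_ltn_trans (ltn_ord i).
move=> R F v0 F1; apply: prod_vertices_le => //.
- by move=> j; case: (stP j).
- move=> i; have Hi : verts H (v i) by apply/vP; exists i.
  have [e1 [e2 [/incP[j1 <- i1] /incP[j2 <- i2] ne]]] := two_incident Hi.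
  apply/card_gt1P; exists j1, j2; rewrite !inE; split=> //.
  by apply/eqP => j12; apply: ne; rewrite j12.
- move=> A /card_gt0P[i0 Ai0] Ak; apply: contrapT => nc.
  have cut j : A (s j) = A (t j).
    by apply/eqP; apply: contrapT => h; apply: nc; exists j; apply/negP.
  (* If no edge left [A], its image would be closed under adjacency and so contain every vertex. *)
  suff : verts H `<=` [set x | exists2 i, A i & v i = x].
    move=> AH; move: Ak; rewrite ltnNge => /negP; apply.
    apply: subset_leq_card; apply/fintype.subsetP => i _.
    have [|i' Ai' /vI <-//] := AH (v i).
    by apply/vP; exists i.
  apply: (@closed_under_adjacency _ (v i0)); [by exists i0|by apply/vP; exists i0|].
  move=> _ z [i Ai <-] [d /eP[j <-]]; rewrite eE => E0; case: (set2_eq E0) => -[].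
    by move=> /vI si tz; exists (t j) => //; rewrite -cut si.
  by move=> sz /vI ti; exists (s j) => //; rewrite cut ti.
- have [x [e1 [e2 [e3 [/vP[i <-] /incP[j1 <- i1] /incP[j2 <- i2] /incP[j3 <- i3]
    [n12 n13 n23]]]]]] := three_incident.
  exists i; apply/card_gt2P; exists j1, j2, j3; rewrite !inE; split=> //.
  by split; apply/eqP => jj; [apply: n12|apply: n23|apply: n13]; rewrite jj.
Qed.
End Core.

(** * Adding a pendant edge *)

Lemma card_I1P T (A : set T) : (A #= `I_1)%card -> exists x, A = [set x].
Proof.
move=> /eq_cardSP[x Ax]; rewrite II0 card_eq0 => /eqP A0; exists x.
apply/seteqP; split => y /=; last by move=> ->.
move=> Ay; apply: contrapT => yx.
by have : (A `\ x) y by []; rewrite A0.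
Qed.

Definition pendant_extension V E (H H' : mgraph V E) (r u : V) (e0 : E) :=
  [/\ verts H' r, ~ verts H' u, ~ edges H' e0,
      verts H = verts H' `|` [set u] /\ edges H = edges H' `|` [set e0]
    & ends H e0 = [set r; u] /\ forall e, edges H' e -> ends H' e = ends H e].

(** The tree at [r = root u] has only the vertices [r] and [u]. It has an edge because it is
    connected, and only one because it is acyclic. *)
Lemma two_core_pendant V E (H H' : mgraph V E) :
  loopless_multigraph H -> two_core H H' ->
  (verts H `\` verts H' #= `I_1)%card ->
  exists r u e0, pendant_extension H H' r u e0.
Proof.
move=> Hloop [[sv se sc] conn multi leaf [root [rootH root_id root_e trees]]].
move=> /card_I1P[u Du].
have [Hu nu] : (verts H `\` verts H') u by rewrite Du.
have Duu x : verts H x -> ~ verts H' x -> x = u.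
  by move=> Hx nx; have : (verts H `\` verts H') x by []; rewrite Du.
have Hr := rootH _ Hu; set r := root u in Hr.
have ru : r <> u by move=> ru; apply: nu; rewrite -ru.
pose tv := [set x | verts H x /\ root x = r].
pose te := [set e | [/\ edges H e, ~ edges H' e & forall x, ends H e x -> root x = r]].
have [[_ tconn] tacyc] := trees _ Hr.
have tvP x : tv x -> x = r \/ x = u.
  move=> [Hx xr]; have [H'x|nx] := pselect (verts H' x).
    by left; rewrite -xr root_id.
  by right; exact: Duu.
(* The ends of an extra edge share their root, while core vertices are their own roots and [u] is
   the only other vertex. *)
have extra e : edges H e -> ~ edges H' e -> ends H e = [set r; u].
  move=> He ne; have [x [y [Hx Hy xy ee]]] := Hloop _ He.
  have rxy : root x = root y by apply: (root_e e) => //; rewrite ee; [left|right].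
  have [H'x|nx] := pselect (verts H' x); have [H'y|ny] := pselect (verts H' y).
  - by exfalso; apply: xy; rewrite -(root_id _ H'x) -(root_id _ H'y).
  - rewrite ee -(root_id _ H'x) rxy (Duu y)//.
  - by rewrite ee -(root_id _ H'y) -rxy (Duu x)// setUC.
  - by exfalso; apply: xy; rewrite (Duu x)// (Duu y).
have tr : tv r by split; [exact: sv|exact: root_id].
have tu : tv u by [].
have [e0 [He0 ne0]] : exists e0, edges H e0 /\ ~ edges H' e0.
  have /clos_rt_rt1n_iff c := tconn r u tr tu.
  by case: c ru => // z y [e [He ne _] _] _ _; exists e.
exists r, u, e0; split=> //; split.
- apply/seteqP; split => x /=.
    by move=> Hx; have [?|?] := pselect (verts H' x); [left|right; exact: Duu].
  by case=> [/sv//|->].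
- apply/seteqP; split => e /=; last by case=> [/se//|->].
  move=> He; have [?|ne] := pselect (edges H' e); [by left|right].
  apply: contrapT => ee0.
  (* A second extra edge would be parallel to [e0] and close a cycle of length 2. *)
  suff : cycles (sub_mgraph H (tv, te)) (tv, [set e0; e]) by rewrite tacyc.
  have te0 d : edges H d -> ~ edges H' d -> te d.
    by move=> Hd nd; split=> // x; rewrite extra// => -[->|->//]; exact: root_id.
  exists 2 => //; split.
    split => //=; first by move=> d [->|->]; exact: te0.
    move=> d dd; split=> // x; rewrite extra; first by case=> ->.
    + by case: dd => ->.
    + by case: dd => ->.
  exists (fun i => if i == 0%N then r else u), (fun i => if i == 0%N then e0 else e).
  split=> /=.
  + apply/set_bijP; split => /=.
    * by move=> i _; case: ifP.
    * by move=> [|[|i]] [|[|j]] //= _ _ // eq_ru; case: ru; rewrite eq_ru.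
    * by move=> x /tvP[]->; [exists 0%N|exists 1%N].
  + apply/set_bijP; split => /=.
    * by move=> i _; case: ifP; [left|right].
    * by move=> [|[|i]] [|[|j]] //= _ _ // eq_ee; case: ee0.
    * by move=> x []->; [exists 0%N|exists 1%N].
  + move=> [|[|i]]//= _; rewrite extra//.
      by rewrite image_setU !image_set1.
    by rewrite image_setU !image_set1 /= setUC.
- exact: extra.
- by move=> e /sc[].
Qed.

Section CopiesOfExtension.
Variables (V E VG EG : Type) (H H' : mgraph V E) (G : mgraph VG EG).
Variables (r u : V) (e0 : E).
Hypothesis ext : pendant_extension H H' r u e0.
Hypothesis closedH' : closed_mgraph H'.
Hypothesis two_inc : forall x, verts H' x ->
  exists e1 e2, [/\ incident H' x e1, incident H' x e2 & e1 <> e2].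
Hypothesis closedG : closed_mgraph G.

(* The vertices of the copy [S] that can play the role of [r]. *)
Definition root_images (S : set VG * set EG) : set VG :=
  [set x | exists f g, iso_by H' (sub_mgraph G S) f g /\ f r = x].

Definition leaving_edges (S : set VG * set EG) (x : VG) : set EG :=
  [set e | edges G e /\ exists2 y, ~ S.1 y & ends G e = [set x; y]].

Definition add_edge (S : set VG * set EG) (e : EG) : set VG * set EG :=
  (S.1 `|` ends G e, S.2 `|` [set e]).

(** Extend the isomorphism taking [r] to [x] by sending [u] to the outer end of [e] and [e0] to
    [e]. *)
Lemma copies_add_edge S x e : copies H' G S -> root_images S x ->
  leaving_edges S x e -> copies H G (add_edge S e).
Proof.
move=> [[/= sv se sc] _] [f [g [[/set_bijP[fA fI fS] /set_bijP[gA gI gS] fg] frx]]] [Ge [y nSy ee]].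
have [Hr nu ne0 [HV HE] [Hee0 H'e]] := ext.
split.
  split=> /=.
  - by move=> z [/sv//|]; exact: closedG.
  - by move=> d [/se//|->].
  - move=> d dd; split=> // z dz; case: dd dz => [/sc[_ h]|->] dz; [left; exact: h|by right].
pose f1 z := if pselect (z = u) then y else f z.
pose g1 d := if pselect (d = e0) then e else g d.
have f1u : f1 u = y by rewrite /f1; case: pselect.
have g1e : g1 e0 = e by rewrite /g1; case: pselect.
have f1E z : verts H' z -> f1 z = f z.
  by move=> Hz; rewrite /f1; case: pselect => // zu; case: nu; rewrite -zu.
have g1E z : edges H' z -> g1 z = g z.
  by move=> Hz; rewrite /g1; case: pselect => // zu; case: ne0; rewrite -zu.
have Sx : S.1 x by rewrite -frx; exact: fA.
have nSe : ~ S.2 e.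
  by move=> /sc[_ /(_ y)]; rewrite /= ee => h; apply: nSy; apply: h; right.
exists f1, g1; split.
- rewrite HV; apply/set_bijP; split => /=.
  + move=> z [Hz|->]; [left; rewrite f1E//; exact: fA|right; rewrite f1u ee; by right].
  + move=> a b [Ha|->] [Hb|->]; rewrite ?f1u ?f1E//.
    * exact: fI.
    * by move=> fay; case: nSy; rewrite -fay; exact: fA.
    * by move=> fay; case: nSy; rewrite fay; exact: fA.
  + move=> z [/fS[a Ha <-]|]; first by exists a; [left|rewrite f1E].
    rewrite ee => -[->|->]; last by exists u; [right|].
    by exists r; [left|rewrite f1E].
- rewrite HE; apply/set_bijP; split => /=.
  + move=> z [Hz|->]; [left; rewrite g1E//; exact: gA|by right].
  + move=> a b [Ha|->] [Hb|->]; rewrite ?g1e ?g1E//.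
    * exact: gI.
    * by move=> fay; case: nSe; rewrite -fay; exact: gA.
    * by move=> fay; case: nSe; rewrite fay; exact: gA.
  + move=> z [/gS[a Ha <-]|->]; first by exists a; [left|rewrite g1E].
    by exists e0; [right|].
- rewrite HE => d [Hd|->] /=.
    rewrite g1E//; have /= -> := fg _ Hd; rewrite H'e//.
    have cl : ends H d `<=` verts H' by rewrite -H'e//; exact: closedH'.
    apply/seteqP; split => _ [z dz <-]; exists z => //; rewrite f1E//; exact: cl.
  by rewrite g1e ee Hee0 image_setU !image_set1 f1u f1E// frx.
Qed.

(** Restrict the isomorphism to the core; by injectivity the image of [u] lies outside the
    restricted copy. *)
Lemma copies_extension_inv S : copies H G S ->
  exists C x e, [/\ copies H' G C, root_images C x, leaving_edges C x e
    & S = add_edge C e].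
Proof.
move=> [[/= sv se sc] [f [g [/set_bijP[fA fI fS] /set_bijP[gA gI gS] fg]]]].
have [Hr nu ne0 [HV HE] [Hee0 H'e]] := ext.
have Hv z : verts H' z -> verts H z by rewrite HV; left.
have Hd z : edges H' z -> edges H z by rewrite HE; left.
have Hu : verts H u by rewrite HV; right.
have He0 : edges H e0 by rewrite HE; right.
pose C := (f @` verts H', g @` edges H').
have iso : iso_by H' (sub_mgraph G C) f g.
  split.
  - apply/set_bijP; split => [z Hz|a b Ha Hb|//]; first by exists z.
    by apply: fI; exact: Hv.
  - apply/set_bijP; split => [z Hz|a b Ha Hb|//]; first by exists z.
    by apply: gI; exact: Hd.
  - by move=> d H'd; rewrite H'e//; exact: fg (Hd _ H'd).
have ends0 : ends G (g e0) = [set f r; f u].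
  by have /= -> := fg _ He0; rewrite Hee0 image_setU !image_set1.
exists C, (f r), (g e0); split.
- split; last by exists f, g.
  split=> /=.
  + by move=> _ [z Hz <-]; apply/sv/fA/Hv.
  + by move=> _ [z Hz <-]; apply/se/gA/Hd.
  + move=> _ [d H'd <-]; split=> //.
    have [_ _ /(_ _ H'd) /= ->] := iso.
    by move=> _ [z dz <-]; exists z => //; exact: closedH' dz.
- by exists f, g.
- split; first exact/se/gA.
  exists (f u) => //= -[z Hz /fI zu]; apply: nu; rewrite -zu//; exact: Hv.
- rewrite [S]surjective_pairing /add_edge ends0 /C /=; congr pair.
    apply/seteqP; split => z /=.
      move=> /fS[a Ha <-]; move: Ha; rewrite HV => -[Ha|->]; first by left; exists a.
      by right; right.
    by case=> [[a Ha <-]|[->|->]]; apply: fA => //; exact: Hv.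
  apply/seteqP; split => z /=.
    move=> /gS[a Ha <-]; move: Ha; rewrite HE => -[Ha|->]; first by left; exists a.
    by right.
  by case=> [[a Ha <-]|->]; apply: gA => //; exact: Hd.
Qed.

Lemma copy_two_incident C y : copies H' G C -> C.1 y ->
  exists e1 e2, [/\ C.2 e1 /\ ends G e1 y, C.2 e2 /\ ends G e2 y & e1 <> e2].
Proof.
move=> [_ [f [g [/set_bijP[fA fI fS] /set_bijP[gA gI gS] fg]]]] /fS[v Hv <-].
have [e1 [e2 [[H1 v1] [H2 v2] ne]]] := two_inc Hv.
exists (g e1), (g e2); split.
- by split; [exact: gA|have /= -> := fg _ H1; exists v].
- by split; [exact: gA|have /= -> := fg _ H2; exists v].
- by move=> /gI h; apply: ne; exact: h.
Qed.

(* The added edge is recovered as the only edge at the vertex of degree one. *)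
Lemma add_edge_inj C x e C' x' e' :
  copies H' G C -> root_images C x -> leaving_edges C x e ->
  copies H' G C' -> root_images C' x' -> leaving_edges C' x' e' ->
  add_edge C e = add_edge C' e' -> [/\ C = C', x = x' & e = e'].
Proof.
move=> cC rC [Ge [y nCy ee]] cC' rC' [Ge' [y' nCy' ee']].
have root_in D z : root_images D z -> D.1 z.
  move=> [f [g [[/set_bijP[fA _ _] _ _] <-]]]; apply: fA.
  by have [] := ext.
have Cx := root_in _ _ rC; have Cx' := root_in _ _ rC'.
have not_in D z d : copies H' G D -> ~ D.1 z -> D.2 d -> ~ ends G d z.
  by move=> [[_ _ sc] _] nz /sc[_ h] /h.
rewrite /add_edge => -[E1 E2].
(* Otherwise [y'] lies in [C] and has two edges of [C] at it. Both belong to the enlarged [C'],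
   where [e'] is the only edge at [y']. *)
have yy' : y = y'.
  apply: contrapT => nyy'.
  have Cy' : C.1 y'.
    have : (C'.1 `|` ends G e') y' by rewrite ee'; right; right.
    by rewrite -E1 ee => -[//|[->//|yy]]; case: nyy'.
  have only d : C.2 d -> ends G d y' -> d = e'.
    move=> Cd dy'; have : (C'.2 `|` [set e']) d by rewrite -E2; left.
    by case=> // /(not_in _ _ _ cC' nCy').
  have [e1 [e2 [[C1 y1] [C2 y2]]]] := copy_two_incident cC Cy'; apply.
  by rewrite (only _ C1 y1) (only _ C2 y2).
subst y'.
have eE : e = e'.
  have : (C'.2 `|` [set e']) e by rewrite -E2; right.
  case=> // C'e; exfalso; apply: (not_in _ _ _ cC' nCy' C'e).
  by rewrite ee; right.
subst e'.
have xx' : x = x'.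
  have := ee; rewrite ee' => h; have [[->//]|[x'y _]] := set2_eq h.
  by case: nCy'; rewrite -x'y.
subst x'; split=> //.
have ney d D : copies H' G D -> ~ D.1 y -> D.2 d -> d <> e.
  by move=> cD nD Dd de; apply: (not_in _ _ _ cD nD Dd); rewrite de ee; right.
have half D D' : copies H' G D -> copies H' G D' -> ~ D.1 y -> D'.1 x -> 
    D.1 `|` ends G e `<=` D'.1 `|` ends G e -> D.2 `|` [set e] `<=` D'.2 `|` [set e] ->
    D.1 `<=` D'.1 /\ D.2 `<=` D'.2.
  move=> cD cD' nD D'x s1 s2; split.
    move=> z Dz; have : (D'.1 `|` ends G e) z by apply: s1; left.
    rewrite ee => -[//|[->//|zy]]; by case: nD; rewrite -zy.
  move=> d Dd; have : (D'.2 `|` [set e]) d by apply: s2; left.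
  by case=> // de; case: (ney _ _ cD nD Dd).
have [||h1 h2] := half _ _ cC cC' nCy Cx'; [by rewrite E1|by rewrite E2|].
have [||h3 h4] := half _ _ cC' cC nCy' Cx; [by rewrite E1|by rewrite E2|].
rewrite [C]surjective_pairing [C']surjective_pairing.
by congr pair; apply/seteqP; split.
Qed.
End CopiesOfExtension.

(** * Copies in a realization of the attachment graph *)

(** The orbit of [r] under the automorphism group; permuting parallel edges does not multiply its
    elements. *)
Definition automorphic_images V E (G : mgraph V E) (r : V) : set V :=
  [set x | exists f g, iso_by G G f g /\ f r = x].

(** Composition with one fixed isomorphism onto [S] maps the orbit bijectively, so the number of
    attachment vertices is the same for all copies. *)
Lemma root_images_card V E (VG : pointedType) EG (H' : mgraph V E) (G : mgraph VG EG) r S :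
  E -> closed_mgraph H' -> verts H' r -> copies H' G S ->
  (automorphic_images H' r #= root_images H' G r S)%card.
Proof.
move=> d cl Hr [_ [f0 [g0 iso0]]].
have [/set_bijP[fA fI fS] _ _] := iso0.
have [f' [g' [iso' f'K]]] := iso_by_inverse (fun=> r) (fun=> d) cl iso0.
apply/card_set_bijP; exists f0; apply/set_bijP; split.
- move=> _ [f [g [iso <-]]]; exists (f0 \o f), (g0 \o g); split=> //.
  exact: iso_by_comp iso iso0.
- move=> _ _ [f [g [[/set_bijP[h _ _] _ _] <-]]] [f1 [g1 [[/set_bijP[h1 _ _] _ _] <-]]].
  by apply: fI; [exact: h|exact: h1].
- move=> _ [f [g [iso <-]]]; exists (f' (f r)).
    by exists (f' \o f), (g' \o g); split=> //; exact: iso_by_comp iso iso'.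
  have [/set_bijP[h _ _] _ _] := iso.
  by have [z Hz <-] := fS _ (h _ Hr); rewrite f'K.
Qed.

Lemma finite_subsets T (A : set T) : finite_set A -> finite_set [set B | B `<=` A].
Proof.
move=> /finite_set_enum[n [f [_ fP]]].
pose phi (b : {ffun 'I_n -> bool}) : set T := [set x | exists2 i, b i & f i = x].
apply: (@sub_finite_set _ _ (phi @` setT)); last exact/finite_image/finite_finset.
move=> B BA; exists [ffun i => `[< B (f i) >]] => //.
apply/seteqP; split => x /=.
  by move=> [i]; rewrite ffunE => /asboolP Bi <-.
move=> Bx; have /fP[i fi] := BA _ Bx; exists i => //.
by rewrite ffunE; apply/asboolP; rewrite fi.
Qed.

Lemma card_fset_set_seq (T : choiceType) (s : seq T) :
  uniq s -> #|` fset_set [set` s]| = size s.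
Proof.
move=> us; rewrite (_ : [set` s] = [set` [fset x in s]%fset]).
  by rewrite set_fsetK card_fseq undup_id.
by apply/seteqP; split => x /=; rewrite inE.
Qed.

Lemma card_fset_set_leD (T : choiceType) (A B X : set T) :
  finite_set B -> finite_set X -> A `<=` B `|` X ->
  (#|` fset_set A| <= #|` fset_set B| + #|` fset_set X|)%N.
Proof.
move=> fB fX AS.
have fBX : finite_set (B `|` X) by rewrite finite_setU.
have fA : finite_set A := sub_finite_set AS fBX.
apply: (@leq_trans #|` fset_set (B `|` X)|).
  by apply: fsubset_leq_card; rewrite -fset_set_sub.
by rewrite fset_setU// cardfsU leq_subr.
Qed.

Lemma cvg_sum_seq (R : realType) (I : eqType) (s : seq I) (f : I -> nat -> R) (l : R) :
  (forall i, i \in s -> f i n @[n --> \oo] --> l) ->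
  \sum_(i <- s) f i n @[n --> \oo] --> l * (size s)%:R.
Proof.
elim: s => [|i s IH] h.
  rewrite mulr0 (_ : (fun n => _) = fun=> 0); first exact: cvg_cst.
  by apply/funext => n; rewrite big_nil.
rewrite (_ : (fun n => _) = fun n => f i n + \sum_(i <- s) f i n); last first.
  by apply/funext => n; rewrite big_cons.
rewrite /= -natr1 mulrDr mulr1 addrC; apply: cvgD.
  by apply: h; rewrite mem_head.
by apply: IH => j js; apply: h; rewrite inE js orbT.
Qed.

Section Realization.
Variables (R : realType) (T : Type) (m : nat) (U : nat * nat -> T -> nat) (w : T).
Hypothesis U_range : forall k, (2 <= k.1)%N -> (1 <= k.2 <= m)%N ->
  (1 <= U k w < k.1)%N.

Let Ginf := Gm_infty m U w.
Let G n := Gmn m U n w.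

Lemma Ginf_closed : closed_mgraph Ginf.
Proof.
move=> [[j i] a] [/= j2 am ->] x.
have /andP[/= U1 Uj] := U_range (k := (j, a)) j2 am.
by case=> -> /=; lia.
Qed.

Lemma G_closed n : closed_mgraph (G n).
Proof.
move=> e [/= Ge en] x ex; split; last exact: en.
exact: Ginf_closed ex.
Qed.

Lemma copies_GnE VH EH (H : mgraph VH EH) n :
  copies H (G n) = [set S | copies H Ginf S /\ S.1 `<=` [set i | (1 <= i <= n)%N]].
Proof.
apply/seteqP; split => S.
  move=> [[/= sv se sc] iso]; split; last by move=> x /sv[].
  split=> //; split=> /=.
  - by move=> x /sv[].
  - by move=> e /se[].
  - by move=> e /sc[].
move=> [[[/= sv se sc] iso] Sn]; split=> //; split=> /=.
- by move=> x Sx; split; [exact: sv|exact: Sn].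
- move=> e Se; split; first exact: se.
  by have [_ h] := sc _ Se; move=> x /h /Sn.
- by move=> e /sc[].
Qed.

Section FinitelyManyCopies.
Variables (V E : Type) (H : mgraph V E) (k l : nat).
Variables (v : 'I_k -> V) (e : 'I_l -> E) (s t : 'I_l -> 'I_k).
Hypothesis vI : injective v.
Hypothesis vP : forall x, verts H x <-> exists i, v i = x.
Hypothesis eI : injective e.
Hypothesis eP : forall d, edges H d <-> exists j, e j = d.
Hypothesis eE : forall j, ends H (e j) = [set v (s j); v (t j)].
Variable N : nat.
Hypothesis bound : forall (F : 'I_k -> nat) (L : 'I_l -> nat),
  admissible m s t F L ->
  (forall j, U (maxn (F (s j)) (F (t j)), L j) w = minn (F (s j)) (F (t j))) ->
  forall i, (F i <= N)%N.

(** Read through the enumerations, an isomorphism onto [S] is an admissible labelling realized by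
    the choices, to which [bound] applies. *)
Lemma copies_bounded S : copies H Ginf S -> S.1 `<=` `I_N.+1.
Proof.
move=> [[/= sv se _] [f [g [/set_bijP[fA fI fS] /set_bijP[gA gI gS] fg]]]] x /fS[z /vP[i <-] <-].
have vH i' : verts H (v i') by apply/vP; exists i'.
have eH j : edges H (e j) by apply/eP; exists j.
pose F i := f (v i); pose L j := (g (e j)).2.
have key j : [/\ (1 <= L j <= m)%N, F (s j) <> F (t j),
    U (maxn (F (s j)) (F (t j)), L j) w = minn (F (s j)) (F (t j))
    & g (e j) = (maxn (F (s j)) (F (t j)), minn (F (s j)) (F (t j)), L j)].
  have := se _ (gA _ (eH j)); have := fg _ (eH j); rewrite eE image_setU !image_set1 /=.
  rewrite /L; case: (g (e j)) => [[J I] a] /=; rewrite /edge_ends /= => E0 [J2 am IU].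
  have /= := U_range (k := (J, a)) J2 am; rewrite -IU => /andP[I1 IJ].
  have [[sJ tI]|[sI tJ]] := set2_eq (esym E0).
    rewrite /F sJ tI (maxn_idPl (ltnW IJ)) (minn_idPr (ltnW IJ)); split=> //; lia.
  rewrite /F sI tJ (maxn_idPr (ltnW IJ)) (minn_idPl (ltnW IJ)); split=> //; lia.
rewrite /= ltnS -/(F i); apply: (bound (L := L)); last by move=> j; case: (key j).
split.
- by move=> i'; apply: (sv (f (v i'))); exact: fA.
- by move=> j; case: (key j).
(* Equal keys are one choice and so have the same older end, which makes the two image edges
   equal. *)
- move=> j1 j2 [h1 h2]; apply: eI; apply: gI => //.
  have [_ _ U1 ->] := key j1; have [_ _ U2 ->] := key j2.
  by rewrite -U1 -U2 h1 h2.
- by move=> j; case: (key j).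
Qed.

Lemma finite_copies : finite_set (copies H Ginf).
Proof.
pose X := [set e : nat * nat * nat | (e.1.1 <= N)%N /\ (e.1.2 <= N)%N /\ (e.2 <= m)%N].
have fX : finite_set X.
  apply: (@sub_finite_set _ _ ((`I_N.+1 `*` `I_N.+1) `*` `I_m.+1)).
    by move=> [[j i] a] [? [? ?]].
  by do !apply: finite_setX; exact: finite_II.
apply: (@sub_finite_set _ _ ([set B | B `<=` `I_N.+1] `*` [set B | B `<=` X])).
  move=> S cS; split; first exact: copies_bounded.
  have [[/= _ se sc] _] := cS.
  move=> [[j i] a] Se /=; have [/= _ am _] := se _ Se; have [_ /= h] := sc _ Se.
  have jN := copies_bounded cS (h j (or_introl erefl)).
  have iN := copies_bounded cS (h i (or_intror erefl)).
  by move: jN iN am; rewrite /X /= !ltnS; lia.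
by apply: finite_setX; apply: finite_subsets => //; exact: finite_II.
Qed.

Lemma copies_stable n : (N <= n)%N -> copies H (G n) = copies H Ginf.
Proof.
move=> Nn; rewrite copies_GnE; apply/seteqP; split => S; first by case.
move=> cS; split=> // x Sx; have [[/= sv _ _] _] := cS.
have := copies_bounded cS Sx; have := sv _ Sx; rewrite /=; lia.
Qed.
End FinitelyManyCopies.

Lemma finite_leaving_edges C x n : finite_set (leaving_edges (G n) C x).
Proof.
apply: (@sub_finite_set _ _ ((`I_n.+1 `*` `I_n.+1) `*` `I_m.+1)); last first.
  by do !apply: finite_setX; exact: finite_II.
move=> [[j i] a] [[[/= j2 am iU] en] _].
have := en j (or_introl erefl); have := en i (or_intror erefl).
by move: am; rewrite /= !ltnS; lia.
Qed.

(** The leaving edges and the edges received from younger vertices differ only within a finite set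
    independent of [n], negligible after division by [ln n]. *)
Lemma leaving_edges_cvg (C : set nat * set (nat * nat * nat)) x :
  finite_set C.1 -> (1 <= x)%N ->
  (younger_degree m U x n w)%:R / ln n%:R @[n --> \oo] --> (m%:R : R) ->
  #|` fset_set (leaving_edges (G n) C x)|%:R / ln n%:R @[n --> \oo] --> (m%:R : R).
Proof.
move=> fC x1 dcvg.
pose B n := [seq (k.1, x, k.2) | k <- younger_keys m x n & U k w == x].
have uB n : uniq (B n).
  rewrite map_inj_uniq ?filter_uniq ?uniq_younger_keys//.
  by move=> [? ?] [? ?] [-> ->].
have sB n : #|` fset_set [set` B n]| = younger_degree m U x n w.
  by rewrite card_fset_set_seq// size_map size_filter.
(* The exceptions are the edges that [x] sends to older vertices and the edges sent to [x] by
   vertices of [C]. *)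
pose X : set (nat * nat * nat) := [set (x, U (x, a) w, a) | a in `I_m.+1] `|`
   [set (p.1, x, p.2) | p in C.1 `*` `I_m.+1].
have fX : finite_set X.
  rewrite /X finite_setU; split; apply: finite_image; first exact: finite_II.
  by apply: finite_setX => //; exact: finite_II.
have AB n : leaving_edges (G n) C x `<=` [set` B n] `|` X.
  move=> [[j i] a] [[[/= j2 am iU] en] [y nCy ee]].
  have /= := U_range (k := (j, a)) j2 am; rewrite -iU => /andP[i1 ij].
  have jn := en j (or_introl erefl); rewrite /= in jn.
  have [[/= jx iy]|[/= jy ix]] := set2_eq ee.
    by right; left; exists a; rewrite /= ?ltnS; [case/andP: am|rewrite -jx -iU].
  left; apply/mapP; exists (j, a); last by rewrite /= ix.
  by rewrite mem_filter -iU ix eqxx mem_younger_keys /= am andbT -ix; lia.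
have BA n : [set` B n] `<=` leaving_edges (G n) C x `|` X.
  move=> _ /mapP[[j a] + ->]; rewrite mem_filter mem_younger_keys /=.
  move=> /andP[/eqP Ux /andP[/andP[xj jn] am]].
  have [Cj|nCj] := pselect (C.1 j).
    by right; right; exists (j, a) => //=; split=> //; rewrite /= ltnS; case/andP: am.
  left; split; last by exists j => //; rewrite setUC.
  split; first by split=> //=; lia.
  by move=> z /= [->|->] /=; lia.
pose K := #|` fset_set X|.
have K0 : K%:R / ln n%:R @[n --> \oo] --> (0 : R).
  apply: (@cvg_div_ln R (fun=> K%:R)) => //.
  rewrite mul0r -(mulr0 K%:R); apply: cvgMr.
  rewrite (_ : (fun k => _) = fun k => @harmonic R k * @harmonic R k); last first.
    by apply/funext => i; rewrite /harmonic /= natrX expr2 invfM.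
  by rewrite -[X in _ --> X](mulr0 0); apply: cvgM; exact: cvg_harmonic.
apply: (@squeeze_cvgr _ _ _ _
  (fun n => (younger_degree m U x n w)%:R / ln n%:R - K%:R / ln n%:R)
  (fun n => (younger_degree m U x n w)%:R / ln n%:R + K%:R / ln n%:R)).
- exists 1%N => // n /= n1; rewrite -mulrBl -mulrDl.
  have ln0 : 0 <= (ln n%:R)^-1 :> R by rewrite invr_ge0 ln_ge0// ler1n.
  have h1 := card_fset_set_leD (finite_seq (B n)) fX (@AB n).
  have h2 := card_fset_set_leD (finite_leaving_edges C x n) fX (@BA n).
  rewrite sB in h1 h2.
  by rewrite !ler_wpM2r// -?natrD ?ler_nat// lerBlDr -natrD ler_nat.
- by rewrite -[X in _ --> X]subr0; apply: cvgB.
- by rewrite -[X in _ --> X]addr0; apply: cvgD.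
Qed.

End Realization.

(** * Counting the copies of the extended graph *)

Lemma ncopies_seq (R : realType) V1 E1 V2 E2 (H : mgraph V1 E1) (G : mgraph V2 E2)
    (s : seq (set V2 * set E2)) :
  uniq s -> copies H G = [set` s] -> ncopies R H G = (size s)%:R%:E.
Proof.
move=> us cs; rewrite /ncopies cs /counting asboolT; last exact: finite_seq.
by rewrite card_fset_set_seq.
Qed.

Section Realization.
Variables (R : realType) (T : Type) (m : nat) (U : nat * nat -> T -> nat) (w : T).
Hypothesis U_range : forall k, (2 <= k.1)%N -> (1 <= k.2 <= m)%N ->
  (1 <= U k w < k.1)%N.

Let Ginf := Gm_infty m U w.
Let G n := Gmn m U n w.

Hypothesis degree_cvg : forall x, (1 <= x)%N ->
  (younger_degree m U x n w)%:R / ln n%:R @[n --> \oo] --> (m%:R : R).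

Variables (V E : Type) (H H' : mgraph V E) (r u : V) (e0 : E) (o N : nat).
Hypothesis ext : pendant_extension H H' r u e0.
Hypothesis closedH' : closed_mgraph H'.
Hypothesis finH' : finite_set (verts H').
Hypothesis two_inc : forall x, verts H' x ->
  exists e1 e2, [/\ incident H' x e1, incident H' x e2 & e1 <> e2].
Hypothesis oP : (automorphic_images H' r #= `I_o)%card.
Hypothesis finC : finite_set (copies H' Ginf).
Hypothesis stable : forall n, (N <= n)%N -> copies H' (G n) = copies H' Ginf.

Let Cs : seq (set nat * set (nat * nat * nat)) := fset_set (copies H' Ginf).
Let uCs : uniq Cs. Proof. exact: fset_uniq. Qed.
Let CsP C : (C \in Cs) <-> copies H' Ginf C.
Proof. by rewrite /Cs in_fset_set// inE. Qed.

Let CsE : copies H' Ginf = [set` Cs].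
Proof. by apply/seteqP; split => C /CsP. Qed.

Let roots (C : set nat * set (nat * nat * nat)) : seq nat :=
  fset_set (root_images H' Ginf r C).

Let card_roots C : copies H' Ginf C -> (root_images H' Ginf r C #= `I_o)%card.
Proof.
move=> cC; have [Hr _ _ _ _] := ext.
apply: card_eq_trans oP; apply: card_esym.
exact: (root_images_card e0 closedH' Hr cC).
Qed.

Let rootsP C x : copies H' Ginf C -> (x \in roots C) <-> root_images H' Ginf r C x.
Proof.
move=> cC; rewrite /roots in_fset_set ?inE//.
by apply/finite_setP; exists o; exact: card_roots.
Qed.

(** Core copies with a chosen attachment vertex form a list that does not depend on [n]; only the
    leaving edges at each pair grow. *)
Let Zs := [seq (C, x) | C <- Cs, x <- roots C].

Let size_Zs : size Zs = (o * size Cs)%N.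
Proof.
rewrite size_allpairs_dep.
have : {in Cs, forall C, size (roots C) = o}.
  by move=> C /CsP cC; apply: card_fset_set; exact: card_roots.
elim: (Cs) => [|C s IH] h; first by rewrite muln0.
rewrite /= h ?mem_head// IH ?mulnS// => D Ds; apply: h.
by rewrite inE Ds orbT.
Qed.

Let ZsP C x : ((C, x) \in Zs) <-> copies H' Ginf C /\ root_images H' Ginf r C x.
Proof.
split.
  by move=> /allpairsPdep[C' [x' [/CsP cC /(rootsP _ cC) rx [-> ->]]]].
move=> [cC rx]; apply/allpairsPdep; exists C, x; split=> //; first exact/CsP.
exact/rootsP.
Qed.

Let leaving n (z : set nat * set (nat * nat * nat) * nat) : seq (nat * nat * nat) :=
  fset_set (leaving_edges (G n) z.1 z.2).

Let leavingP n z e : (e \in leaving n z) <-> leaving_edges (G n) z.1 z.2 e.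
Proof.
by rewrite /leaving in_fset_set ?inE//; exact: finite_leaving_edges.
Qed.

Let Ss n := [seq add_edge (G n) z.1 e | z <- Zs, e <- leaving n z].

Let uZs : uniq Zs.
Proof.
apply: allpairs_uniq_dep => //.
  by move=> C _; exact: fset_uniq.
by move=> [C x] [C' x'] _ _ /= [-> ->].
Qed.

Let uSs n : (N <= n)%N -> uniq (Ss n).
Proof.
move=> Nn; apply: allpairs_uniq_dep => //.
  by move=> z _; exact: fset_uniq.
move=> p p' /allpairsPdep[[C x] [e [/ZsP[cC rx] /leavingP le ->]]].
move=> /allpairsPdep[[C' x'] [e' [/ZsP[cC' rx'] /leavingP le' ->]]] /= E0.
rewrite -(stable Nn) in cC cC'.
by have [-> -> ->] := add_edge_inj ext two_inc cC rx le cC' rx' le' E0.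
Qed.

Let SsE n : (N <= n)%N -> copies H (G n) = [set` Ss n].
Proof.
move=> Nn; have clG := G_closed U_range (n := n).
apply/seteqP; split => S.
  move=> /(copies_extension_inv ext closedH')[C [x [e [cC rx le ->]]]].
  rewrite (stable Nn) in cC.
  apply/allpairsPdep; exists (C, x), e; split=> //; first exact/ZsP.
  exact/leavingP.
move=> /allpairsPdep[[C x] [e [/ZsP[cC rx] /leavingP le ->]]].
rewrite -(stable Nn) in cC.
exact: (copies_add_edge ext closedH' clG cC rx le).
Qed.

Lemma ncopies_infty : ncopies R H' Ginf = (size Cs)%:R%:E.
Proof. exact: ncopies_seq. Qed.

(** The size is a sum over the fixed list [Zs] of numbers of leaving edges, each asymptotic to
    [m * ln n]. *)
Lemma ncopies_extension_cvg :
  (size (Ss n))%:R / ln n%:R @[n --> \oo] --> ((m * o)%:R * (size Cs)%:R : R).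
Proof.
rewrite natrM -mulrA -natrM -size_Zs.
rewrite (_ : (fun n => _) = fun n => \sum_(z <- Zs) (size (leaving n z))%:R / ln n%:R).
  apply: cvg_sum_seq => -[C x] /ZsP[cC rx].
  have Cx : C.1 x.
    by case: rx => f [g [[/set_bijP[fA _ _] _ _] <-]]; apply: fA; case: ext.
  have [[/= sv _ _] [f [g [[_ _ fS] _ _]]]] := cC.
  apply: leaving_edges_cvg => //=; [|exact: sv|exact/degree_cvg/sv].
  by apply: (@sub_finite_set _ _ (f @` verts H')) => //; exact: finite_image.
apply/funext => n; rewrite -mulr_suml size_allpairs_dep; congr (_ / _).
by rewrite sumnE big_map natr_sum.
Qed.

Lemma extension_limits :
  (((ln n%:R)^-1)%:E * ncopies R H (G n) -
     ((m * o)%:R)%:E * ncopies R H' (G n))%E @[n --> \oo] --> 0%:E /\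
  (ncopies R H' Ginf < +oo)%E /\
  (((ln n%:R)^-1)%:E * ncopies R H (G n))%E @[n --> \oo]
     --> (((m * o)%:R)%:E * ncopies R H' Ginf)%E.
Proof.
(* From [N] on all counts are finite, which reduces the limits in the extended reals to real
   ones. *)
have Wn n : (N <= n)%N ->
    (((ln n%:R)^-1)%:E * ncopies R H (G n))%E = ((size (Ss n))%:R / ln n%:R)%:E.
  move=> Nn; rewrite (ncopies_seq R (uSs Nn) (SsE Nn)).
  by rewrite muleC EFinM.
have W'n n : (N <= n)%N -> ncopies R H' (G n) = (size Cs)%:R%:E.
  by move=> Nn; apply: ncopies_seq => //; rewrite stable.
have cv := ncopies_extension_cvg.
split; last split; first last.
- rewrite ncopies_infty -EFinM; apply: cvg_EFin.
    by exists N => // n /= Nn; rewrite Wn.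
  apply: cvg_trans cv; apply: near_eq_cvg.
  by exists N => // n /= Nn; rewrite Wn.
- by rewrite ncopies_infty ltry.
- apply: cvg_EFin.
    by exists N => // n /= Nn; rewrite Wn// W'n// -EFinM -EFinB.
  have : (size (Ss n))%:R / ln n%:R - (m * o)%:R * (size Cs)%:R @[n --> \oo]
      --> ((m * o)%:R * (size Cs)%:R - (m * o)%:R * (size Cs)%:R : R).
    by apply: cvgB => //; exact: cvg_cst.
  rewrite subrr; apply: cvg_trans; apply: near_eq_cvg.
  by exists N => // n /= Nn; rewrite Wn// W'n.
Qed.
End Realization.

Theorem theorem3p15 (R : realType) (V E : Type) (H H' : mgraph V E)
    (mH m : nat) :
  loopless_multigraph H -> finite_mgraph H ->
  connected_mgraph H -> multicyclic H ->
  two_core H H' -> (verts H `\` verts H' #= `I_1)%card ->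
  is_mH H mH -> (mH <= m)%N ->
  exists2 c : R, 0 < c &
    forall (d : measure_display) (T : measurableType d) (P : probability T R)
      (U : nat * nat -> {RV P >-> nat}),
      uniform_attachment m U ->
      let W n w : \bar R := ncopies R H (Gmn m U n w) in
      let W' n w : \bar R := ncopies R H' (Gmn m U n w) in
      let W'_infty w : \bar R := ncopies R H' (Gm_infty m U w) in
      {ae P, forall w,
        (((ln n%:R)^-1)%:E * W n w - c%:E * W' n w)%E @[n --> \oo] --> 0%:E} /\
      {ae P, forall w,
        (W'_infty w < +oo)%E /\
        (((ln n%:R)^-1)%:E * W n w)%E @[n --> \oo] --> (c%:E * W'_infty w)%E}.
Proof.
move=> Hloop [finV finE] _ _ core one [mH1 _ _] mHm.
have [r [u [e0 ext]]] := two_core_pendant Hloop core one.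
have [[/= sv se sc] conn multi leaf _] := core.
have loop' : loopless_multigraph H'.
  move=> e H'e; have [ee ev] := sc _ H'e.
  have [x [y [_ _ xy exy]]] := Hloop _ (se _ H'e).
  by exists x, y; split=> //; [apply: ev|apply: ev|]; rewrite ee exy//; [left|right].
have fin' : finite_mgraph H' by split; [exact: sub_finite_set finV|exact: sub_finite_set finE].
have closed' := loopless_closed loop'.
have two := @two_incident _ _ _ conn multi leaf.
have [Hr _ _ _ _] := ext.
have [q qP] : exists q, (automorphic_images H' r #= `I_q)%card.
  apply/finite_setP; apply: sub_finite_set (fin'.1).
  by move=> _ [f [g [[/set_bijP[fA _ _] _ _] <-]]]; exact: fA.
(* The identity puts [r] into its own orbit; with [m >= 1] this makes the constant [m * q]
   positive. *)
have q0 : (0 < q)%N.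
  rewrite lt0n; apply/eqP => q0; move: qP; rewrite q0 II0 card_eq0 => /eqP A0.
  have : automorphic_images H' r r.
    exists id, id; split=> //; split; [apply/set_bijP|apply/set_bijP|].
    + by split=> // x Hx; exists x.
    + by split=> // x Hx; exists x.
    + by move=> e _; rewrite image_id.
  by rewrite A0.
have m0 : (0 < m)%N by exact: leq_trans mHm.
exists (m * q)%:R; first by rewrite ltr0n muln_gt0 m0.
move=> d T P U Uua.
pose W n w := ncopies R H (Gmn m U n w).
pose W' n w := ncopies R H' (Gmn m U n w).
pose W'_infty w := ncopies R H' (Gm_infty m U w).
have [k [l [v [e [s [t [[vI vP eI eP eE] k0 prodH]]]]]]] :=
  finite_graph_model loop' conn multi leaf fin'.
have U_range w i : (2 <= i.1)%N -> (1 <= i.2 <= m)%N -> (1 <= U i w < i.1)%N.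
  by move=> i1 i2; have [h _ _] := Uua; apply: h; rewrite /= i1.
have deg : {ae P, forall w, forall x, (younger_degree m U x.+1 n w)%:R / ln n%:R
    @[n --> \oo] --> (m%:R : R)}.
  by apply/ae_foralln => x; exact: younger_degree_cvg.
have emb := finitely_many_embeddings Uua k0 (prodH R).
(* Both limits are deterministic consequences of the degree asymptotics at all vertices together
   with the bound on embeddings, so one almost sure event gives both. *)
have good : {ae P, forall w,
    ((((ln n%:R)^-1)%:E * W n w - ((m * q)%:R)%:E * W' n w)%E @[n --> \oo] --> 0%:E) /\
    ((W'_infty w < +oo)%E /\
     (((ln n%:R)^-1)%:E * W n w)%E @[n --> \oo] --> (((m * q)%:R)%:E * W'_infty w)%E)}.
  apply: filterS2 deg emb => w degw [N bound].
  have bound' (F : 'I_k -> nat) (L : 'I_l -> nat) : admissible m s t F L ->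
    (forall j, U (maxn (F (s j)) (F (t j)), L j) w = minn (F (s j)) (F (t j))) ->
    forall i, (F i <= N)%N.
    by move=> a h; exact: (bound F L).
  apply: (@extension_limits R T m U w _ _ V E H H' r u e0 q N) => //.
  - exact: U_range.
  - by case=> // x _; exact: degw.
  - exact: fin'.1.
  - apply: (@finite_copies T m U w _ V E H' k l v e s t) bound' => //; exact: U_range.
  - move=> n; apply: (@copies_stable T m U w _ V E H' k l v e s t) bound' _ => //; exact: U_range.
by split; apply: filterS good => w [].
Qed.
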